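(* Let $\mathbf{k}$ be a countable discrete field of characteristic zero. Let $A\subseteq L(\mathbf{k}\rtimes\mathbf{k}^* )$ be a $\mathbf{k}\rtimes\mathbf{k}^*$-invariant von Neumann subalgebra whose center satisfies $Z(A)=L(\mathbf{k})^F$ for some non-trivial finite (cyclic) subgroup $F\subseteq\mathbf{k}^*$. Then either $A=L(\mathbf{k})^F$ or $A=L(\mathbf{k}\rtimes F)$.
   Context: $\mathbf{k}^*$ is the multiplicative group of non-zero elements of $\mathbf{k}$, acting on the additive group $\mathbf{k}$ by multiplication; $G=\mathbf{k}\rtimes\mathbf{k}^*$ is the corresponding semidirect product (a discrete group). $L(G)$ is the group von Neumann algebra of $G$, generated by canonical unitaries $v_g$ ($g\in G$). A (unital) von Neumann subalgebra $M\subseteq L(G)$ is $G$-invariant if $v_gMv_g^*=M$ for all $g\in G$. For a subgroup $N\subseteq G$, $L(N)=\{v_g:g\in N\}''\subseteq L(G)$. Write $u_q$ for the canonical unitary of $q\in\mathbf{k}$. For a finite subgroup $F\subseteq\mathbf{k}^*$, $L(\mathbf{k})^F=\{a\in L(\mathbf{k}): a=\sum_{q\in\mathbf{k}}c_qu_q,\ c_q=c_{qf}\ \forall q\in\mathbf{k},\ \forall f\in F\}$ is the fixed point von Neumann subalgebra of $L(\mathbf{k})$ under the $F$-action $u_q\mapsto u_{fq}$. *)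

(* Defs.v *)
From HB Require Import structures.
From mathcomp Require Import all_boot all_order all_algebra finmap complex.
From mathcomp Require Import all_classical all_reals all_analysis.
From mathcomp Require summability.
From mathcomp Require Import ring lra.
Set Implicit Arguments.
Unset Strict Implicit.
Unset Printing Implicit Defensive.
Import Order.TTheory GRing.Theory Num.Theory.
Import numFieldNormedType.Exports.
Local Open Scope classical_set_scope.
Local Open Scope ring_scope.

Section Units.
Variable k : fieldType.

Record units : Type := Units { unit_val :> k; _ : unit_val != 0 }.
HB.instance Definition _ := [isSub for unit_val].
HB.instance Definition _ := [Choice of units by <:].

Implicit Types s t : units.

Lemma unit_neq0 s : unit_val s != 0. Proof. by case: s. Qed.
Definition unit_one : units := Units (oner_neq0 k).
Definition unit_mul s t : units := Units (mulf_neq0 (unit_neq0 s) (unit_neq0 t)).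
Fact unit_inv_subproof s : (unit_val s)^-1 != 0.
Proof. by rewrite invr_eq0 unit_neq0. Qed.
Definition unit_inv s : units := Units (unit_inv_subproof s).

Fact unit_mulA : associative unit_mul.
Proof. by move=> s t u; apply: val_inj; rewrite /= mulrA. Qed.
Fact unit_mul1 : left_id unit_one unit_mul.
Proof. by move=> s; apply: val_inj; rewrite /= mul1r. Qed.
Fact unit_1mul : right_id unit_one unit_mul.
Proof. by move=> s; apply: val_inj; rewrite /= mulr1. Qed.
Fact unit_mulV : left_inverse unit_one unit_inv unit_mul.
Proof. by move=> s; apply: val_inj; rewrite /= mulVf ?unit_neq0. Qed.
Fact unit_Vmul : right_inverse unit_one unit_inv unit_mul.
Proof. by move=> s; apply: val_inj; rewrite /= mulfV ?unit_neq0. Qed.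

HB.instance Definition _ :=
  isGroup.Build units unit_mulA unit_mul1 unit_1mul unit_mulV unit_Vmul.

End Units.

(* The semidirect product of the additive group k by units k; (q, s) stands
   for the map x |-> q + s x. *)
Section Affine.
Variable k : fieldType.

Definition affine : Type := (k * units k)%type.
HB.instance Definition _ := Choice.on affine.

Implicit Types g h : affine.

Definition aff_one : affine := (0, 1%g).
Definition aff_mul g h : affine := (g.1 + unit_val g.2 * h.1, (g.2 * h.2)%g).
Definition aff_inv g : affine := (- ((unit_val g.2)^-1 * g.1), (g.2^-1)%g).

Fact aff_mulA : associative aff_mul.
Proof.
by move=> g h l; congr pair; rewrite /= ?mulrDr ?addrA ?mulrA // mulgA.
Qed.
Fact aff_mul1 : left_id aff_one aff_mul.
Proof. by case=> q s; congr pair; rewrite /= ?add0r ?mul1r ?mul1g. Qed.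
Fact aff_1mul : right_id aff_one aff_mul.
Proof. by case=> q s; congr pair; rewrite /= ?mulr0 ?addr0 ?mulg1. Qed.
Fact aff_mulV : left_inverse aff_one aff_inv aff_mul.
Proof. by case=> q s; congr pair; rewrite /= ?addNr ?mulVg. Qed.
Fact aff_Vmul : right_inverse aff_one aff_inv aff_mul.
Proof.
case=> q s; congr pair; rewrite /= ?mulgV //.
by rewrite mulrN mulVKf ?unit_neq0 // addrN.
Qed.

HB.instance Definition _ :=
  isGroup.Build affine aff_mulA aff_mul1 aff_1mul aff_mulV aff_Vmul.

Definition translation (q : k) : affine := (q, 1%g).

End Affine.

Section Ell2.
Variables (R : realType) (I : choiceType).

Local Notation normc := ComplexField.Normc.normc.

Definition sqnorm (f : I -> R[i]) : \bar R :=
  (\esum_(i in [set: I]) (normc (f i) ^+ 2)%:E)%E.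

Definition sqsummable : {pred I -> R[i]} := fun f => (sqnorm f < +oo)%E.

Fact normc_ge0 (z : R[i]) : 0 <= normc z.
Proof. by case: z => a b; rewrite sqrtr_ge0. Qed.

Fact le_esumZ (c : R) (b : I -> \bar R) : 0 <= c -> (forall i, 0 <= b i)%E ->
  (\esum_(i in [set: I]) (c%:E * b i) <= c%:E * \esum_(i in [set: I]) b i)%E.
Proof.
move=> c0 b0; apply: ge_ereal_sup => _ [A [finA _] <-].
rewrite -ge0_mule_fsumr //; apply: lee_wpmul2l; first by rewrite lee_fin.
by apply: ereal_sup_ubound; exists A.
Qed.

Fact sqsummable_submod_closed : submod_closed sqsummable.
Proof.
have e0 (f : I -> R[i]) i : (0 <= (normc (f i) ^+ 2)%:E)%E.
  by rewrite lee_fin sqr_ge0.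
split.
  rewrite unfold_in /sqnorm (eq_esum (b := fun=> 0%E)) ?esum1 ?ltry //.
  move=> i _; have -> : (0 : I -> R[i]) i = 0 by [].
  by rewrite ComplexField.Normc.normc0 expr0n.
move=> a f g; rewrite !unfold_in /sqnorm => Hf Hg.
have H : (\esum_(i in [set: I]) (normc ((a *: f + g) i) ^+ 2)%:E <=
   \esum_(i in [set: I]) ((2 * normc a ^+ 2)%:E * (normc (f i) ^+ 2)%:E +
     2%:E * (normc (g i) ^+ 2)%:E))%E.
  apply: le_esum => i _; rewrite -!EFinM -EFinD lee_fin.
  have -> : (a *: f + g) i = a * f i + g i by [].
  have := le_normcD (a * f i) (g i); rewrite ComplexField.Normc.normcM.
  set u := normc a; set v := normc (f i); set w := normc (g i) => le1.
  apply: (@le_trans _ _ ((u * v + w) ^+ 2)).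
    by rewrite lerXn2r // nnegrE ?normc_ge0 // (le_trans _ le1) ?normc_ge0.
  rewrite -subr_ge0.
  have -> : 2 * u ^+ 2 * v ^+ 2 + 2 * w ^+ 2 - (u * v + w) ^+ 2
     = (u * v - w) ^+ 2 by ring.
  exact: sqr_ge0.
apply: le_lt_trans H _.
rewrite esumD; first last.
- by move=> i _; rewrite mule_ge0.
- by move=> i _; rewrite mule_ge0 // lee_fin mulr_ge0 // sqr_ge0.
have lty (c : R) (b : I -> R[i]) : 0 <= c -> (sqnorm b < +oo)%E ->
    (\esum_(i in [set: I]) (c%:E * (normc (b i) ^+ 2)%:E) < +oo)%E.
  move=> c0 bfin; apply: le_lt_trans (le_esumZ c0 (e0 b)) _.
  by apply: lte_mul_pinfty; rewrite ?lee_fin.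
apply: lte_add_pinfty; first by apply: lty => //; rewrite mulr_ge0 ?sqr_ge0.
exact: lty.
Qed.


HB.instance Definition _ := GRing.isSubmodClosed.Build R[i] (I -> R[i]) sqsummable
  sqsummable_submod_closed.

Record ell2 : Type := Ell2 { ell2_fun :> I -> R[i]; _ : ell2_fun \in sqsummable }.
HB.instance Definition _ := [isSub for ell2_fun].
HB.instance Definition _ := [Choice of ell2 by <:].
HB.instance Definition _ := [SubChoice_isSubLmodule of ell2 by <:].

Implicit Types x y : ell2.

Definition ell2_norm x : R := Num.sqrt (fine (sqnorm x)).

(* The unconditional sum of a complex family, taken on real and imaginary
   parts; summability.sum is the limit along the finite subsets of I. *)
Definition csum (f : I -> R[i]) : R[i] :=
  Complex (summability.sum (fun i => complex.Re (f i)))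
          (summability.sum (fun i => complex.Im (f i))).

Lemma sum_reindex (e e' : I -> I) (f : I -> R) :
  cancel e e' -> cancel e' e -> summability.sum (f \o e) = summability.sum f.
Proof.
move=> eK e'K; rewrite /summability.sum; congr (lim _).
have ps (h h' : I -> I) (u : I -> R) (A : {fset I}) : cancel h h' -> 
    summability.partial_sum (u \o h) A =
    summability.partial_sum u [fset h i | i in A]%fset.
  move=> hK; rewrite /summability.partial_sum.
  rewrite -(big_seq_fsetE _ A xpredT (u \o h)) /=.
  rewrite -(big_seq_fsetE _ _ xpredT u) /= big_imfset //= => i j _ _.
  exact: (can_inj hK).
have incl (h h' : I -> I) (u : I -> R) P : cancel h h' -> cancel h' h ->
    (summability.partial_sum u @ summability.totally) P ->
    (summability.partial_sum (u \o h) @ summability.totally) P.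
  move=> hK h'K [A _ AP]; exists [fset h' i | i in A]%fset => // B /= AB.
  rewrite (ps _ h') //; apply: AP => /=; apply/fsubsetP => i iA.
  rewrite -(h'K i); apply: in_imfset => /=.
  by apply: (fsubsetP AB); apply: in_imfset.
apply/seteqP; split=> P; last exact: incl eK e'K.
by move/(incl e' e (f \o e) P e'K eK); rewrite -compA (_ : e \o e' = id) //;
  apply/funext => i; apply: e'K.
Qed.

Lemma csum_reindex (e e' : I -> I) (f : I -> R[i]) :
  cancel e e' -> cancel e' e -> csum (f \o e) = csum f.
Proof.
move=> eK e'K; rewrite /csum.
rewrite -(sum_reindex (fun i => complex.Re (f i)) eK e'K).
by rewrite -(sum_reindex (fun i => complex.Im (f i)) eK e'K).
Qed.

Definition dot x y : R[i] := csum (fun i => x i * (y i)^*).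

Fact delta_subproof (i : I) : (fun j => (j == i)%:R : R[i]) \in sqsummable.
Proof.
rewrite unfold_in /sqnorm.
rewrite (eq_esum (b := fun j => if j \in [set i] then 1%E else 0%E)).
  by rewrite -esum_mkcond esum_set1 ?ltry.
move=> j _; case: eqP => [->|ji]; [rewrite mem_set // | rewrite memNset //].
  by rewrite ComplexField.Normc.normc1 expr1n.
by rewrite ComplexField.Normc.normc0 expr0n.
Qed.
Definition delta (i : I) : ell2 := Ell2 (delta_subproof i).

End Ell2.

Section Operators.
Variables (R : realType) (I : choiceType).
Local Notation H := (ell2 R I).
Implicit Types (S T : H -> H) (M : set (H -> H)).

Definition bounded_op T : Prop :=
  linear T /\ exists c : R, forall x, ell2_norm (T x) <= c * ell2_norm x.

Definition adjoint S T : Prop := forall x y, dot (S x) y = dot x (T y).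

Definition commutant M : set (H -> H) :=
  [set T | bounded_op T /\ forall S, M S -> S \o T = T \o S].

Definition bicommutant M : set (H -> H) := commutant (commutant M).

Record von_neumann_algebra M : Prop := VonNeumannAlgebra {
  vna_bounded : forall T, M T -> bounded_op T;
  vna_unit : M id;
  vna_add : forall S T, M S -> M T -> M (fun x => S x + T x);
  vna_scale : forall (c : R[i]) T, M T -> M (fun x => c *: T x);
  vna_mul : forall S T, M S -> M T -> M (S \o T);
  vna_adjoint : forall T, M T -> exists2 S, M S & adjoint T S;
  vna_bicommutant : bicommutant M = M }.

Definition vn_center M : set (H -> H) := M `&` commutant M.

End Operators.

Section GroupVonNeumann.
Variables (R : realType) (G : groupType).
Local Notation H := (ell2 R G).

Fact regular_subproof (g : G) (x : H) :
  (fun h => x (g^-1 * h)%g) \in @sqsummable R G.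
Proof.
have xS : (ell2_fun x) \in @sqsummable R G by case: x.
move: xS; rewrite !unfold_in /sqnorm.
rewrite (reindex_esum [set: G] [set: G] (fun h => g^-1 * h)%g) //.
split=> // [h1 h2 _ _|h _]; first exact: mulgI.
by exists (g * h)%g; rewrite // mulKg.
Qed.
Definition regular (g : G) (x : H) : H := Ell2 (regular_subproof g x).

Lemma regular_adjoint (g : G) : adjoint (regular g) (regular g^-1).
Proof.
move=> x y; rewrite /dot.
have -> : (fun h => x h * (regular g^-1 y h)^*) =
    (fun h => regular g x h * (y h)^*) \o (fun h => g * h)%g.
  by apply/funext => h; rewrite /= mulKg invgK.
by rewrite (csum_reindex _ (mulKg g) (mulVKg g)).
Qed.

(* regular g is the canonical unitary v_g; group_vna N is L(N) inside L(G). *)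
Definition group_vna (N : set G) : set (H -> H) :=
  bicommutant [set regular g | g in N].

Definition vn_subalgebra (A : set (H -> H)) : Prop :=
  von_neumann_algebra A /\ A `<=` group_vna [set: G].

(* The adjoint of regular g is regular g^-1 by regular_adjoint. *)
Definition conj_invariant (A : set (H -> H)) : Prop :=
  forall g : G, [set regular g \o T \o regular g^-1 | T in A] = A.

(* The coefficient c_g in the expansion T = \sum_g c_g v_g, which converges
   in the 2-norm, i.e. after evaluation at delta 1. *)
Definition fourier_coef (T : H -> H) (g : G) : R[i] := T (delta R 1%g) g.

End GroupVonNeumann.
Arguments group_vna R {G} N _.

(* L_translations is L(k), L_semidirect F is L(k ><| F) and
   L_translations_fixed F is L(k)^F, all acting on ell2 (k ><| k^* ). *)
Section AffineAlgebras.
Variables (R : realType) (k : fieldType).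
Local Notation H := (ell2 R (affine k)).

Definition L_semidirect (F : {fset units k}) : set (H -> H) :=
  group_vna R [set g : affine k | g.2 \in F].

Definition L_translations : set (H -> H) :=
  group_vna R (range (@translation k)).

Definition L_translations_fixed (F : {fset units k}) : set (H -> H) :=
  [set T | L_translations T /\ forall (q : k) (f : units k), f \in F ->
     fourier_coef T (translation q) =
     fourier_coef T (translation (q * unit_val f))].

End AffineAlgebras.
Arguments L_semidirect R {k} F _.
Arguments L_translations : clear implicits.
Arguments L_translations_fixed R {k} F _.

(* Main.v *)
Require Import Defs.
From HB Require Import structures.
From mathcomp Require Import cyclic algC cyclotomic.
From mathcomp Require Import all_boot all_order all_algebra finmap complex.
From mathcomp Require Import all_classical all_reals all_analysis.
From mathcomp Require Import ring lra.
Set Implicit Arguments.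
Unset Strict Implicit.
Unset Printing Implicit Defensive.
Import Order.TTheory GRing.Theory Num.Theory.
Local Open Scope classical_set_scope.
Local Open Scope ring_scope.

(** Write u_q for the translation by q and v_f for the dilation by f; every T
in the von Neumann algebra of G = k ><| k^* is determined by its Fourier
coefficients c(q, s), which are square summable.

The elements m_p = \sum_(f in F) u_(pf) lie in L(k)^F, so they are central in A.
Comparing coefficients in T m_p = m_p T at (q + p, s) and letting p run
through the natural numbers, square summability kills every term whose argument
moves: what is left is c(q, s) on one side and 0 on the other as soon as s is
not in F [commute_orbit_sum_coef].  So A is supported on k ><| F, which is
L(k ><| F) [group_vna_support].  If A is even supported on k, it is abelian and
equals its center.

Otherwise some T in A has c(q, s) != 0 with s in F, s != 1.  All further
information is extracted from A by weak limits [bicommutant_limit]: a conjugate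
or product of elements of A depending on an integer n, with uniformly bounded
norm, has a limit in A, and terms carried by group elements that leave every
finite set disappear.
- Conjugation by dilations n pushes c(q, _) to infinity for q != 0, which
  leaves the finite element \sum_(f in F) c(0, f) v_f of A.  Conjugating first
  by a translation makes its coefficient a_s at s nonzero, since 1 - s is
  invertible [exists_dilation_part].
- Let x be that element.  The product of the conjugates of x by u_n and by
  u_(n^2) and of m_p, where p = r - (1 - s) n - s (1 - s) n^2, is a sum of terms
  indexed by (f, g, h) in F^3, carried by group elements whose translation part
  is a polynomial of degree at most 2 in n.  That polynomial is constant only if
  1 - g = f (1 - s) and g (1 - h) = f s (1 - s), and this forces f = 1, g = h = s
  [chord_ratio].  The limit is a_s^2 u_r v_(s^2); hence all u_r are in A
  [mem_translation].
- Now u_n x u_(-n/s) tends to a_s v_s, so v_s is in A [mem_dilation].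

Thus A is supported on k ><| K, where K is the group of those s in F with v_s
in A.  The element \sum_(f in K) u_f commutes with k ><| K, hence is central in
A, hence has F-invariant coefficients, so K = F and A = L(k ><| F).

Characteristic zero makes multiples of a nonzero element of k run off to
infinity.  It also gives chord_ratio: integral polynomial relations between roots
of unity are preserved by inversion, because cyclotomic polynomials are
irreducible over the rationals. *)

(** * Squared moduli and squared norms *)
Section SquareModulus.
Variable R : realType.
Implicit Types z w : R[i].

Definition sqmod z : R := ComplexField.Normc.normc z ^+ 2.

Lemma sqmod_ge0 z : 0 <= sqmod z. Proof. exact: sqr_ge0. Qed.

Lemma sqmod0 : sqmod 0 = 0.
Proof. by rewrite /sqmod ComplexField.Normc.normc0 expr0n. Qed.

Lemma sqmod1 : sqmod 1 = 1.
Proof. by rewrite /sqmod ComplexField.Normc.normc1 expr1n. Qed.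

Lemma sqmodM z w : sqmod (z * w) = sqmod z * sqmod w.
Proof. by rewrite /sqmod ComplexField.Normc.normcM exprMn. Qed.

Lemma sqmod_eq0 z : sqmod z = 0 -> z = 0.
Proof.
by move/eqP; rewrite expf_eq0 => /andP[_ /eqP]; apply: ComplexField.Normc.eq0_normc.
Qed.

Lemma sqmodN z : sqmod (- z) = sqmod z.
Proof. by rewrite /sqmod normcN. Qed.

(** Squares are used throughout in place of norms: this weak form of the
triangle inequality is enough for every estimate below. *)
Lemma sqmodD z w : sqmod (z + w) <= 2 * sqmod z + 2 * sqmod w.
Proof.
have := le_normcD z w; rewrite /sqmod.
have := normc_ge0 z; have := normc_ge0 w; have := normc_ge0 (z + w).
move: (ComplexField.Normc.normc _) (ComplexField.Normc.normc z) (ComplexField.Normc.normc w).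
move=> a b c a0 c0 b0 h.
apply: (@le_trans _ _ ((b + c) ^+ 2)); first by rewrite lerXn2r ?nnegrE ?addr_ge0.
rewrite -subr_ge0; have -> : 2 * b ^+ 2 + 2 * c ^+ 2 - (b + c) ^+ 2 = (b - c) ^+ 2 by ring.
exact: sqr_ge0.
Qed.

Lemma sqmod_conjM z : exists2 w, w * z = (sqmod z)%:C%C & sqmod w = sqmod z.
Proof.
case: z => a b; exists (Complex a (- b)).
  rewrite /sqmod /= sqr_sqrtr ?addr_ge0 ?sqr_ge0 //.
  by apply/eqP; rewrite eq_complex /=; apply/andP; split; apply/eqP; ring.
by rewrite /sqmod /= sqrrN.
Qed.

Lemma sqmod_real (t : R) : sqmod t%:C%C = t ^+ 2.
Proof. by rewrite /sqmod /= expr0n addr0 sqr_sqrtr ?sqr_ge0. Qed.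

(** A substitute for the Cauchy-Schwarz inequality, which follows termwise from
2xy <= x^2 / e + e y^2. *)
Lemma sqmod_sumM (I : Type) (s : seq I) (u v : I -> R[i]) (e b : R) :
  0 < e -> \sum_(i <- s) sqmod (u i) <= e ^+ 2 -> \sum_(i <- s) sqmod (v i) <= b ->
  sqmod (\sum_(i <- s) u i * v i) <= (e * (1 + b)) ^+ 2.
Proof.
move=> e0 ub vb.
pose n := fun z : R[i] => ComplexField.Normc.normc z.
have nsum : n (\sum_(i <- s) u i * v i) <= \sum_(i <- s) n (u i) * n (v i).
  elim: s {ub vb} => [|i s IH]; first by rewrite !big_nil /n ComplexField.Normc.normc0.
  rewrite !big_cons; apply: le_trans (le_normcD _ _) _.
  by rewrite ComplexField.Normc.normcM lerD2l.
have b0 : 0 <= b by apply: le_trans vb; apply: sumr_ge0 => i _; apply: sqmod_ge0.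
rewrite /sqmod lerXn2r ?nnegrE ?normc_ge0 ?mulr_ge0 ?addr_ge0 ?(ltW e0) //.
apply: (le_trans nsum).
apply: (@le_trans _ _ (e^-1 * \sum_(i <- s) sqmod (u i) + e * \sum_(i <- s) sqmod (v i))).
  rewrite !mulr_sumr -big_split /=; apply: ler_sum => i _.
  rewrite /sqmod -/(n (u i)) -/(n (v i)).
  have := normc_ge0 (u i); have := normc_ge0 (v i); rewrite -/(n _) -/(n (u i)).
  move: (n (u i)) (n (v i)) => x y y0 x0.
  have -> : e^-1 * x ^+ 2 + e * y ^+ 2 = e^-1 * (x - e * y)^+2 + x * y + x * y.
    by field; rewrite gt_eqF.
  have : 0 <= e^-1 * (x - e * y) ^+ 2 by rewrite mulr_ge0 ?sqr_ge0 ?invr_ge0 ?ltW.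
  have : 0 <= x * y by apply: mulr_ge0.
  lra.
have -> : e * (1 + b) = e^-1 * e ^+ 2 + e * b by field; rewrite gt_eqF.
by apply: lerD; apply: ler_wpM2l; rewrite ?invr_ge0 ?(ltW e0).
Qed.

End SquareModulus.

Section SquareNorm.
Variables (R : realType) (I : choiceType).
Local Notation H := (ell2 R I).
Implicit Types (x y : H) (s t : seq I).

Definition sqn x : R := fine (sqnorm x).

Lemma sqnorm_fin x : sqnorm x = (sqn x)%:E.
Proof.
have : (ell2_fun x) \in @sqsummable R I by case: x.
rewrite unfold_in /sqn => h; rewrite fineK // ge0_fin_numE //.
by apply: esum_ge0 => i _; rewrite lee_fin sqr_ge0.
Qed.

Lemma sqn_ge0 x : 0 <= sqn x.
Proof.
by rewrite -lee_fin -sqnorm_fin; apply: esum_ge0 => i _; rewrite lee_fin sqr_ge0.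
Qed.

Lemma sum_le_sqnorm (f : I -> R[i]) s : uniq s ->
  ((\sum_(i <- s) sqmod (f i))%:E <= sqnorm f)%E.
Proof.
move=> us; apply: ereal_sup_ubound; exists [set` s].
  by split => //; apply: finite_seq.
by rewrite -fsbig_seq //= sumEFin.
Qed.

Lemma sum_le_sqn x s : uniq s -> \sum_(i <- s) sqmod (x i) <= sqn x.
Proof. by move=> us; rewrite -lee_fin -sqnorm_fin sum_le_sqnorm. Qed.

Lemma sqnorm_le (f : I -> R[i]) (c : R) :
  (forall s, uniq s -> \sum_(i <- s) sqmod (f i) <= c) -> (sqnorm f <= c%:E)%E.
Proof.
move=> h; apply: ge_ereal_sup => _ [A [finA _] <-].
rewrite fsbig_finite //= sumEFin lee_fin; apply: h; exact: fset_uniq.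
Qed.

Lemma sqn_le x (c : R) :
  (forall s, uniq s -> \sum_(i <- s) sqmod (x i) <= c) -> sqn x <= c.
Proof. by move=> h; rewrite -lee_fin -sqnorm_fin sqnorm_le. Qed.

Lemma sqmod_le_sqn x i : sqmod (x i) <= sqn x.
Proof. by have := @sum_le_sqn x [:: i] isT; rewrite big_seq1. Qed.

Lemma ell2P x y : (forall i, x i = y i) -> x = y.
Proof. by move=> h; apply: val_inj; apply/funext. Qed.

Lemma ell2D x y (i : I) : (x + y) i = x i + y i. Proof. by []. Qed.
Lemma ell2N x (i : I) : (- x) i = - x i. Proof. by []. Qed.
Lemma ell2Z (a : R[i]) x (i : I) : (a *: x) i = a * x i. Proof. by []. Qed.
Lemma ell2_sum (J : Type) (r : seq J) (f : J -> H) (i : I) :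
  (\sum_(j <- r) f j) i = \sum_(j <- r) f j i.
Proof. by elim: r => [|j r IH]; rewrite ?big_nil // !big_cons ell2D IH. Qed.
Lemma deltaE (i j : I) : delta R i j = (j == i)%:R. Proof. by []. Qed.

Lemma sqnD x y : sqn (x + y) <= 2 * sqn x + 2 * sqn y.
Proof.
apply: sqn_le => s us.
apply: (@le_trans _ _ (\sum_(i <- s) (2 * sqmod (x i) + 2 * sqmod (y i)))).
  by apply: ler_sum => i _; apply: sqmodD.
by rewrite big_split -!mulr_sumr /= lerD // ler_wpM2l // sum_le_sqn.
Qed.

Lemma sqnZ (a : R[i]) x : sqn (a *: x) <= sqmod a * sqn x.
Proof.
apply: sqn_le => s us; under eq_bigr do rewrite sqmodM.
by rewrite -mulr_sumr ler_wpM2l ?sqmod_ge0 ?sum_le_sqn.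
Qed.

Lemma sqn0 : sqn 0 = 0.
Proof.
apply/eqP; rewrite eq_le sqn_ge0 andbT; apply: sqn_le => s _.
by rewrite big1 // => i _; rewrite sqmod0.
Qed.

Lemma sqn_sum (J : eqType) (r : seq J) (f : J -> H) (c : R) : 0 <= c ->
  (forall j, j \in r -> sqn (f j) <= c) ->
  sqn (\sum_(j <- r) f j) <= 4 ^+ size r * c.
Proof.
move=> c0; elim: r => [|j r IH] fc; first by rewrite big_nil sqn0 expr0 mul1r.
have {}IH := IH (fun i ir => fc i (mem_behead (s := j :: r) ir)).
rewrite big_cons /= exprS; have {}fc := fc j (mem_head _ _).
have p1 : 1 <= 4 ^+ size r :> R by rewrite exprn_ege1 // ler1n.
have := sqnD (f j) (\sum_(j <- r) f j); move: fc.
have : c <= 4 ^+ size r * c by rewrite ler_peMl.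
move: IH; set a := sqn _; set b := sqn _; set d := _ * c; set g := sqn _.
by rewrite -mulrA -/d; lra.
Qed.

Lemma sqn_delta i : sqn (delta R i) <= 1.
Proof.
apply: sqn_le => s us.
have [si|si] := boolP (i \in s).
  rewrite (bigD1_seq i) //= eqxx sqmod1 big1 ?addr0 // => j ji.
  by rewrite (negPf ji) sqmod0.
rewrite big_seq big1 // => j js; rewrite deltaE; have [ji|_] := eqVneq j i.
  by rewrite -ji js in si.
by rewrite sqmod0.
Qed.

(** Defined for arbitrary functions, so that it also builds test vectors. *)
Definition trunc s (w : I -> R[i]) : H := \sum_(i <- s) w i *: delta R i.

Lemma truncE s (w : I -> R[i]) j : uniq s -> trunc s w j = if j \in s then w j else 0.
Proof.
move=> us; rewrite /trunc ell2_sum.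
under eq_bigr do rewrite ell2Z deltaE.
case: ifP => [js|/negbT js].
  rewrite (bigD1_seq j) //= eqxx mulr1 big1 ?addr0 // => i ij.
  by rewrite eq_sym (negPf ij) mulr0.
rewrite big_seq big1 // => i si; have [ji|_] := eqVneq j i.
  by rewrite ji si in js.
by rewrite mulr0.
Qed.

Lemma sqn_trunc s (w : I -> R[i]) : uniq s ->
  sqn (trunc s w) <= \sum_(i <- s) sqmod (w i).
Proof.
move=> us; apply: sqn_le => r ur.
rewrite (eq_bigr (fun i => if i \in s then sqmod (w i) else 0)); last first.
  by move=> i _; rewrite truncE //; case: ifP => // _; rewrite sqmod0.
rewrite -big_mkcond -big_filter /=.
pose r' := [seq i <- r | i \in s]; rewrite -/r'.
have hp : perm_eq r' [seq i <- s | i \in r].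
  apply: uniq_perm; rewrite ?filter_uniq // => i.
  by rewrite !mem_filter andbC.
rewrite (perm_big _ hp) /= big_filter [leRHS](bigID (mem r)) /= lerDl.
by apply: sumr_ge0 => i _; apply: sqmod_ge0.
Qed.

Lemma sqn_subtrunc s x : uniq s -> sqn (x - trunc s x) <= sqn x.
Proof.
move=> us; apply: sqn_le => t ut; apply: le_trans (sum_le_sqn x ut).
apply: ler_sum => i _; rewrite ell2D ell2N truncE //.
by case: ifP => _; rewrite ?subrr ?subr0 // sqmod0 sqmod_ge0.
Qed.

(** Finitely supported vectors are dense; the approximation is uniform over
all finite index sets that are large enough, so that one set can serve several
vectors. *)
Lemma trunc_approx x (e : R) : 0 < e -> exists2 s, uniq s &
  forall t, uniq t -> {subset s <= t} -> sqn (x - trunc t x) <= e.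
Proof.
move=> e0.
have [s us hs] : exists2 s, uniq s & sqn x - e < \sum_(i <- s) sqmod (x i).
  apply: contrapT => h.
  have : sqn x <= sqn x - e.
    apply: sqn_le => s us; rewrite leNgt; apply/negP => hs.
    by apply: h; exists s.
  by move: e0; lra.
exists s => // t ut st; apply: sqn_le => r ur.
pose r' := [seq i <- r | i \notin t].
have -> : \sum_(i <- r) sqmod ((x - trunc t x) i) = \sum_(i <- r') sqmod (x i).
  rewrite big_filter [RHS]big_mkcond; apply: eq_bigr => i _.
  rewrite ell2D ell2N truncE //; case: (i \in t); first by rewrite subrr sqmod0.
  by rewrite subr0.
have ur' : uniq (s ++ r').
  rewrite cat_uniq us filter_uniq // andbT /=; apply/hasPn => i.
  by rewrite mem_filter => /andP[it _]; apply: contra it => /st.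
have := sum_le_sqn x ur'; rewrite big_cat /=.
move: hs; set a := \sum_(i <- s) _; set b := \sum_(i <- r') _; lra.
Qed.

End SquareNorm.

(** * Bounded operators and their matrix coefficients *)
Section Operators.
Variables (R : realType) (I : choiceType).
Local Notation H := (ell2 R I).
Implicit Types (S T : H -> H) (M : set (H -> H)) (x y z : H).

Lemma bounded_opP T : bounded_op T <->
  linear T /\ exists2 c : R, 0 <= c & forall x, sqn (T x) <= c * sqn x.
Proof.
split=> [[lT [c hc]]|[lT [c c0 hc]]]; split=> //.
  exists (c ^+ 2); first exact: sqr_ge0.
  move=> x; have := hc x; rewrite /ell2_norm -/(sqn x) -/(sqn (T x)) => h.
  rewrite -(sqr_sqrtr (sqn_ge0 x)) -(sqr_sqrtr (sqn_ge0 (T x))) -exprMn.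
  by rewrite lerXn2r ?nnegrE ?sqrtr_ge0 // (le_trans (sqrtr_ge0 _) h).
exists (Num.sqrt c) => x; rewrite /ell2_norm -/(sqn x) -/(sqn (T x)).
by rewrite -sqrtrM // ler_wsqrtr.
Qed.

Lemma lin0 T : linear T -> T 0 = 0.
Proof.
move=> lT; have := lT (-1) 0 0.
by rewrite scaler0 addr0 scaleN1r addNr.
Qed.

Lemma linD T x y : linear T -> T (x + y) = T x + T y.
Proof. by move=> lT; have := lT 1 x y; rewrite !scale1r. Qed.

Lemma linZ T (a : R[i]) x : linear T -> T (a *: x) = a *: T x.
Proof. by move=> lT; have := lT a x 0; rewrite !addr0 lin0 // addr0. Qed.

Lemma linB T x y : linear T -> T (x - y) = T x - T y.
Proof. by move=> lT; rewrite linD // -scaleN1r linZ // scaleN1r. Qed.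

Lemma lin_sum T (J : Type) (r : seq J) (f : J -> H) : linear T ->
  T (\sum_(j <- r) f j) = \sum_(j <- r) T (f j).
Proof.
by move=> lT; elim: r => [|j r IH]; rewrite ?big_nil ?lin0 // !big_cons linD // IH.
Qed.

Lemma lin_trunc T s (w : I -> R[i]) j : linear T ->
  T (trunc s w) j = \sum_(i <- s) w i * T (delta R i) j.
Proof.
move=> lT; rewrite lin_sum // ell2_sum; apply: eq_bigr => i _.
by rewrite linZ // ell2Z.
Qed.

Lemma sqmod_small (z : R[i]) (K : R) : 0 <= K ->
  (forall e, 0 < e -> sqmod z <= K * e) -> z = 0.
Proof.
move=> K0 h; apply: sqmod_eq0; apply/eqP; rewrite eq_le sqmod_ge0 andbT.
rewrite leNgt; apply/negP => z0.
have K1 : 0 < K + 1 by lra.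
have K2 : 0 < 2 * (K + 1) by lra.
have := h _ (divr_gt0 z0 K2); rewrite mulrA ler_pdivlMr //.
by move: (sqmod z) z0 => a; nra.
Qed.

Lemma bounded_op_ext S T : bounded_op S -> bounded_op T ->
  (forall i j, S (delta R i) j = T (delta R i) j) -> S = T.
Proof.
move=> /bounded_opP[lS [c c0 hc]] /bounded_opP[lT [d d0 hd]] h.
apply/funext => x; apply: ell2P => j; apply/eqP; rewrite -subr_eq0; apply/eqP.
apply: (@sqmod_small _ (2 * (c + d))) => [|e e0].
  by rewrite mulr_ge0 ?addr_ge0.
have [s us /(_ s us) hs] := trunc_approx x e0.
have {}hs := hs (fun=> id); set z := x - _ in hs.
have -> : S x j - T x j = S z j + - T z j.
  rewrite /z !linB // !ell2D !ell2N !lin_trunc //.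
  under [in RHS]eq_bigr do rewrite h.
  by ring.
apply: le_trans (sqmodD _ _) _; rewrite sqmodN.
have := sqmod_le_sqn (S z) j; have := sqmod_le_sqn (T z) j.
have := hc z; have := hd z; have := sqn_ge0 z.
have : c * sqn z <= c * e by rewrite ler_wpM2l.
have : d * sqn z <= d * e by rewrite ler_wpM2l.
by lra.
Qed.

Lemma bounded_op_comp S T : bounded_op S -> bounded_op T -> bounded_op (S \o T).
Proof.
move=> /bounded_opP[lS [c c0 hc]] /bounded_opP[lT [d d0 hd]].
apply/bounded_opP; split; first by move=> a x y; rewrite /= lT lS.
exists (c * d); first by rewrite mulr_ge0.
by move=> x /=; apply: le_trans (hc _) _; rewrite -mulrA ler_wpM2l.
Qed.

Lemma bounded_op_sum (J : Type) (r : seq J) (a : J -> R[i]) (T : J -> H -> H) :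
  (forall j, bounded_op (T j)) ->
  bounded_op (fun x => \sum_(j <- r) a j *: T j x).
Proof.
move=> bT; apply/bounded_opP; split.
  move=> b x y; rewrite scaler_sumr -big_split /=; apply: eq_bigr => j _.
  by have [lT _] := bT j; rewrite lT scalerDr !scalerA [a j * b]mulrC.
elim: r => [|j r [c c0 IH]].
  by exists 0 => // x; rewrite big_nil sqn0 mul0r.
have /bounded_opP[lT [d d0 hd]] := bT j.
exists (2 * (sqmod (a j) * d) + 2 * c).
  by apply: addr_ge0; apply: mulr_ge0 => //; apply: mulr_ge0 => //; exact: sqmod_ge0.
move=> x; rewrite big_cons; apply: le_trans (sqnD _ _) _.
rewrite [leRHS]mulrDl -!(mulrA 2); apply: lerD; rewrite ler_wpM2l //.
apply: le_trans (sqnZ _ _) _; rewrite -mulrA ler_wpM2l ?sqmod_ge0 //.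
Qed.

(** Test T on the conjugate of a finite part of the row: the j-th coordinate of
the image is the partial sum a of squares, and boundedness gives a^2 <= c a.  This
plays the part of the existence of an adjoint. *)
Lemma row_sqsummable T j : bounded_op T ->
  (fun i => T (delta R i) j) \in @sqsummable R I.
Proof.
move=> /bounded_opP[lT [c c0 hc]]; rewrite unfold_in.
apply: (@le_lt_trans _ _ c%:E); last exact: ltry.
apply: sqnorm_le => s us.
set r := fun i => T (delta R i) j.
have [w hw1 hw2] : exists2 w : I -> R[i],
    forall i, w i * r i = (sqmod (r i))%:C%C & forall i, sqmod (w i) = sqmod (r i).
  have /choice[w hw] : forall i, exists w : R[i],
      w * r i = (sqmod (r i))%:C%C /\ sqmod w = sqmod (r i).
    by move=> i; have [w ? ?] := sqmod_conjM (r i); exists w.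
  by exists w => i; have [] := hw i.
set a := \sum_(i <- s) _.
have a0 : 0 <= a by apply: sumr_ge0 => i _; apply: sqmod_ge0.
have : a ^+ 2 <= c * a.
  have := sqmod_le_sqn (T (trunc s w)) j.
  rewrite lin_trunc // (eq_bigr _ (fun i _ => hw1 i)) -rmorph_sum /= sqmod_real.
  move=> /le_trans; apply; apply: le_trans (hc _) _; apply: ler_wpM2l => //.
  apply: le_trans (sqn_trunc w us) _.
  by rewrite (eq_bigr _ (fun i _ => hw2 i)).
move: a0; rewrite le_eqVlt => /predU1P[<-//|a0].
by rewrite expr2 ler_pM2r.
Qed.

(** The coordinate z |-> T z j is, uniformly on bounded sets, a limit of finite
sums along the row.  Off the index set t the row has small norm, and there the
inequality sqmod_sumM applies after truncating z. *)
Lemma row_approx T j (Z e : R) : bounded_op T -> 0 <= Z -> 0 < e ->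
  exists2 s, uniq s & forall t, uniq t -> {subset s <= t} ->
  forall z, sqn z <= Z ->
  sqmod (T z j - \sum_(i <- t) z i * T (delta R i) j) <= e.
Proof.
move=> bT Z0 e0; pose r := Ell2 (row_sqsummable j bT).
have /bounded_opP[lT [c c0 hc]] := bT.
(* The choice of e1 makes (e1 * (1 + Z)) ^+ 2 equal to e / 4. *)
pose e1 := Num.sqrt e / (2 * (1 + Z)).
have Z1 : 0 < 1 + Z by lra.
have e10 : 0 < e1 by rewrite divr_gt0 ?mulr_gt0 ?sqrtr_gt0.
have [s us hs] := @trunc_approx _ _ r (e1 ^+ 2) (exprn_gt0 _ e10).
exists s => // t ut st z hz; have {hs} := hs t ut st.
set r' := r - _ => hr'.
pose z' := z - trunc t z.
have -> : T z j - \sum_(i <- t) z i * T (delta R i) j = T z' j.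
  by rewrite /z' linB // ell2D ell2N lin_trunc.
have hz' : sqn z' <= Z by apply: le_trans (sqn_subtrunc _ ut) hz.
have e2 : 0 < e / (4 * (c + 1)) by rewrite divr_gt0 // mulr_gt0 // ltr_wpDl.
have [u uu /(_ u uu (fun=> id))] := trunc_approx z' e2.
set z2 := z' - _ => hz2.
have -> : T z' j = T z2 j + \sum_(i <- u) r' i * z' i.
  have -> : T z' j = T z2 j + T (trunc u z') j.
    by rewrite -ell2D -linD // /z2 subrK.
  congr (_ + _); rewrite lin_trunc //; apply: eq_bigr => i _.
  rewrite mulrC /r' /z' !ell2D !ell2N !truncE //.
  by case: ifP => _; rewrite ?subrr ?mulr0 // !subr0.
apply: le_trans (sqmodD _ _) _.
have h1 : sqmod (T z2 j) <= e / 4.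
  apply: le_trans (sqmod_le_sqn _ _) _; apply: le_trans (hc _) _.
  apply: (@le_trans _ _ (c * (e / (4 * (c + 1))))); first exact: ler_wpM2l.
  rewrite mulrA ler_pdivrMr ?mulr_gt0 ?ltr_wpDl //.
  have -> : e / 4 * (4 * (c + 1)) = c * e + e by field.
  by rewrite lerDl ltW.
have h2 : sqmod (\sum_(i <- u) r' i * z' i) <= e / 4.
  have -> : e / 4 = (e1 * (1 + Z)) ^+ 2.
    rewrite -[in LHS](sqr_sqrtr (ltW e0)) /e1; field.
    by rewrite gt_eqF.
  by apply: sqmod_sumM => //; [apply: le_trans hr' | apply: le_trans hz'];
    apply: sum_le_sqn.
by lra.
Qed.

End Operators.

(** * Weak limits *)
Section Limits.
Variable R : realType.
Implicit Types u v : nat -> R[i].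

Definition tends0 u : Prop :=
  forall e : R, 0 < e -> \forall n \near \oo, sqmod (u n) <= e.

Lemma tends0_near0 u : (\forall n \near \oo, u n = 0) -> tends0 u.
Proof.
by move=> h e e0; near=> n; rewrite (near h n) ?sqmod0 ?(ltW e0) //; near: n.
Unshelve. all: by end_near. Qed.

Lemma tends0_ext u v : u =1 v -> tends0 v -> tends0 u.
Proof. by move=> /funext ->. Qed.

Lemma tends0D u v : tends0 u -> tends0 v -> tends0 (fun n => u n + v n).
Proof.
move=> hu hv e e0; have e4 : 0 < e / 4 by lra.
near=> n; apply: le_trans (sqmodD _ _) _.
have : sqmod (u n) <= e / 4 by near: n; apply: hu.
have : sqmod (v n) <= e / 4 by near: n; apply: hv.
by lra.
Unshelve. all: by end_near. Qed.

Lemma tends0M (a : R[i]) u : tends0 u -> tends0 (fun n => a * u n).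
Proof.
move=> hu e e0; have a1 : 0 < sqmod a + 1 by rewrite ltr_wpDl ?sqmod_ge0.
have e4 : 0 < e / (sqmod a + 1) by rewrite divr_gt0.
near=> n; rewrite sqmodM.
have : sqmod (u n) <= e / (sqmod a + 1) by near: n; apply: hu.
rewrite ler_pdivlMr // => h; apply: le_trans h; rewrite mulrC ler_wpM2l ?sqmod_ge0 //.
by rewrite lerDl.
Unshelve. all: by end_near. Qed.

Lemma tends0_sum (J : eqType) (r : seq J) (u : J -> nat -> R[i]) :
  (forall j, j \in r -> tends0 (u j)) -> tends0 (fun n => \sum_(j <- r) u j n).
Proof.
elim: r => [|j r IH] h.
  by apply: tends0_near0; apply: nearW => n; rewrite big_nil.
rewrite (_ : (fun n => _) = fun n => u j n + \sum_(j <- r) u j n).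
  by apply: tends0D; [apply: h|apply: IH => i ir; apply: h]; rewrite inE ?eqxx ?ir ?orbT.
by apply/funext => n; rewrite big_cons.
Qed.

Lemma tends0_uniq u (a b : R[i]) :
  tends0 (fun n => u n - a) -> tends0 (fun n => u n - b) -> a = b.
Proof.
move=> ha hb; apply/eqP; rewrite -subr_eq0; apply/eqP.
apply: (@sqmod_small R _ 4) => // e e0.
near \oo => n.
have -> : a - b = (u n - b) + - (u n - a) by ring.
apply: le_trans (sqmodD _ _) _; rewrite sqmodN.
have : sqmod (u n - a) <= e by near: n; apply: ha.
have : sqmod (u n - b) <= e by near: n; apply: hb.
by lra.
Unshelve. all: by end_near. Qed.

(** The sequence tends to infinity in the discrete space I. *)
Definition escapes (I : Type) (s : nat -> I) : Prop :=
  forall i, \forall n \near \oo, s n <> i.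

Lemma tends0_escapes (I : choiceType) (x : ell2 R I) (s : nat -> I) :
  escapes s -> tends0 (fun n => x (s n)).
Proof.
move=> hs e e0; have [r ur /(_ r ur (fun=> id)) hr] := trunc_approx x e0.
have h : \forall n \near \oo, s n \notin r.
  elim: r {ur hr} => [|i r IH]; first by apply: nearW.
  near=> n; rewrite inE negb_or; apply/andP; split.
    by apply/eqP; near: n; apply: hs.
  by near: n.
near=> n; apply: le_trans hr.
have := sqmod_le_sqn (x - trunc r x) (s n).
rewrite ell2D ell2N truncE // ifN ?subr0 //.
by near: n.
Unshelve. all: by end_near. Qed.

End Limits.

Section WeakLimits.
Variables (R : realType) (I : choiceType).
Local Notation H := (ell2 R I).
Implicit Types (S T : H -> H) (M : set (H -> H)) (x y z : H).

(** A bounded operator is continuous for coordinatewise convergence of bounded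
sequences. *)
Lemma weakly_continuous T j (z : nat -> H) (Z : R) : bounded_op T ->
  (forall n, sqn (z n) <= Z) -> (forall i, tends0 (fun n => z n i)) ->
  tends0 (fun n => T (z n) j).
Proof.
move=> bT hZ hz e e0.
have Z0 : 0 <= Z by apply: le_trans (hZ 0%N); apply: sqn_ge0.
have e4 : 0 < e / 4 by lra.
have [s us /(_ s us (fun=> id)) hs] := row_approx j bT Z0 e4.
have : tends0 (fun n => \sum_(i <- s) z n i * T (delta R i) j).
  apply: tends0_sum => i _.
  by under eq_fun do rewrite mulrC; apply: tends0M.
move=> h; near=> n.
rewrite -[T _ _](subrK (\sum_(i <- s) z n i * T (delta R i) j)).
apply: le_trans (sqmodD _ _) _; have := hs (z n) (hZ n).
have : sqmod (\sum_(i <- s) z n i * T (delta R i) j) <= e / 4 by near: n; apply: h.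
by lra.
Unshelve. all: by end_near. Qed.

Lemma tends0_apply (U : nat -> H -> H) T (C : R) y j :
  (forall n, linear (U n)) -> (forall n x, sqn (U n x) <= C * sqn x) ->
  bounded_op T ->
  (forall i, tends0 (fun n => U n (delta R i) j - T (delta R i) j)) ->
  tends0 (fun n => U n y j - T y j).
Proof.
move=> lU bU /bounded_opP[lT [c c0 hc]] h e e0.
have C0 : 0 <= `|C| by [].
pose K := 4 * (2 * (`|C| + c) + 1).
have K0 : 0 < K by rewrite /K; lra.
have eK : 0 < e / K by rewrite divr_gt0.
have [s us /(_ s us (fun=> id))] := trunc_approx y eK.
set z := y - _ => hz.
have hs : tends0 (fun n => \sum_(i <- s) y i * (U n (delta R i) j - T (delta R i) j)).
  by apply: tends0_sum => i _; apply: tends0M.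
near=> n.
have -> : U n y j - T y j =
    \sum_(i <- s) y i * (U n (delta R i) j - T (delta R i) j) + (U n z j + - T z j).
  rewrite /z !linB // !ell2D !ell2N !lin_trunc //.
  under eq_bigr do rewrite mulrBr.
  by rewrite sumrB; ring.
apply: le_trans (sqmodD _ _) _.
have h1 : sqmod (\sum_(i <- s) y i * (U n (delta R i) j - T (delta R i) j)) <= e / 4.
  by near: n; apply: hs; lra.
have := sqmodD (U n z j) (- T z j); rewrite sqmodN.
have := le_trans (sqmod_le_sqn (U n z) j) (bU n z).
have := le_trans (sqmod_le_sqn (T z) j) (hc z).
have Cz : C * sqn z <= `|C| * (e / K).
  apply: (@le_trans _ _ (`|C| * sqn z)); last exact: ler_wpM2l.
  by rewrite ler_wpM2r ?sqn_ge0 // ler_norm.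
have cz : c * sqn z <= c * (e / K) by exact: ler_wpM2l.
have eKK : K * (e / K) = e by rewrite mulrC divfK // gt_eqF.
have := ltW eK; move: eKK Cz cz h1; rewrite {1}/K; move: (e / K) => f; lra.
Unshelve. all: by end_near. Qed.

(** Let S be in the commutant.  Along S U_n = U_n S the left side converges by
the weak continuity of S, the right side because uniform boundedness extends
convergence from the basis to all vectors. *)
Theorem bicommutant_limit M (U : nat -> H -> H) T (C : R) :
  (forall n, bicommutant M (U n)) -> (forall n x, sqn (U n x) <= C * sqn x) ->
  bounded_op T ->
  (forall i j, tends0 (fun n => U n (delta R i) j - T (delta R i) j)) ->
  bicommutant M T.
Proof.
move=> MU hU bT hlim; split=> // S MS.
have bS : bounded_op S by case: MS.
have lU n : linear (U n) by have [[]] := MU n.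
apply: bounded_op_ext; [exact: bounded_op_comp|exact: bounded_op_comp|move=> i j /=].
apply: (@tends0_uniq R (fun n => S (U n (delta R i)) j)).
  have /bounded_opP[lS _] := bS; have /bounded_opP[lT [c c0 hc]] := bT.
  under eq_fun do rewrite -ell2N -ell2D -linB //.
  apply: (@weakly_continuous _ _ _ (2 * `|C| + 2 * c)) => // n; last exact: hlim.
  apply: le_trans (sqnD _ _) _.
  have h1 := hU n (delta R i); have h2 := hc (delta R i).
  have h3 : C * sqn (delta R i) <= `|C|.
    apply: (@le_trans _ _ (`|C| * sqn (delta R i))).
      by rewrite ler_wpM2r ?sqn_ge0 // ler_norm.
    by rewrite ler_piMr // sqn_delta.
  have h4 : c * sqn (delta R i) <= c by rewrite ler_piMr // sqn_delta.
  have : sqn (- T (delta R i)) <= c.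
    rewrite -scaleN1r; apply: le_trans (sqnZ _ _) _.
    by rewrite sqmodN sqmod1 mul1r; lra.
  by lra.
have SU n : S (U n (delta R i)) = U n (S (delta R i)).
  by have [_ /(_ S MS) /(congr1 (fun f => f (delta R i)))] := MU n.
under eq_fun do rewrite SU.
by apply: tends0_apply.
Qed.

End WeakLimits.

(** * Commutants *)
Section Commutants.
Variables (R : realType) (I : choiceType).
Local Notation H := (ell2 R I).
Implicit Types (S T : H -> H) (M : set (H -> H)).

Lemma commutant_sum M (J : eqType) (r : seq J) (a : J -> R[i]) (T : J -> H -> H) :
  (forall S, M S -> linear S) -> (forall j, bounded_op (T j)) ->
  (forall j, j \in r -> a j != 0 -> commutant M (T j)) ->
  commutant M (fun x => \sum_(j <- r) a j *: T j x).
Proof.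
move=> lM bT hT; split; first exact: bounded_op_sum.
move=> S MS; apply/funext => x /=; rewrite lin_sum; last exact: lM.
rewrite [LHS]big_seq [RHS]big_seq; apply: eq_bigr => j jr.
have [->|aj] := eqVneq (a j) 0; first by rewrite !scale0r lin0 //; apply: lM.
rewrite linZ; last exact: lM.
have [_ /(_ S MS) /(congr1 (fun f : H -> H => f x)) /= ->] := hT j jr aj.
by [].
Qed.

Lemma commutant_linear M S : commutant M S -> linear S.
Proof. by case=> [[]]. Qed.

Lemma sub_bicommutant M T : bounded_op T -> M T -> bicommutant M T.
Proof. by move=> bT MT; split=> // S [_ /(_ T MT)]. Qed.

Lemma commutantS M M' : M `<=` M' -> commutant M' `<=` commutant M.
Proof. by move=> MM T [bT hT]; split=> // S /MM; apply: hT. Qed.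

Lemma bicommutantS M M' : M `<=` M' -> bicommutant M `<=` bicommutant M'.
Proof. by move=> MM; apply: commutantS; apply: commutantS. Qed.

(** With it a von Neumann algebra contains the inverses of its unitaries without
any appeal to adjoints. *)
Lemma commutant_inv M S T : bounded_op T -> cancel S T -> cancel T S ->
  commutant M S -> commutant M T.
Proof.
move=> bT ST TS [_ hS]; split=> // U MU; apply/funext => x /=.
have /(congr1 (fun f : H -> H => f (T x))) /= := hS U MU.
by rewrite TS => ->; rewrite ST.
Qed.

End Commutants.

(** * Fourier coefficients and supports in a group von Neumann algebra *)
Section GroupOperators.
Variables (R : realType) (G : groupType).
Local Notation H := (ell2 R G).
Implicit Types (S T : H -> H) (M : set (H -> H)) (g h : G) (N : set G).

Lemma regularE g (x : H) h : regular g x h = x (g^-1 * h)%g. Proof. by []. Qed.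

Lemma regular1 : regular (1 : G)%g = (id : H -> H).
Proof.
by apply/funext => x; apply: ell2P => h; rewrite regularE invg1 mul1g.
Qed.

Lemma regularM g h : regular (g * h)%g = regular g \o regular h :> (H -> H).
Proof.
by apply/funext => x; apply: ell2P => i; rewrite regularE /= invgM mulgA.
Qed.

Lemma regular_delta g h : regular g (delta R h) = delta R (g * h)%g.
Proof.
apply: ell2P => i; rewrite regularE !deltaE; congr ((_ : bool)%:R).
by apply/eqP/eqP => [<-|->]; rewrite ?mulVKg ?mulKg.
Qed.

Lemma sqn_regular g (x : H) : sqn (regular g x) <= sqn x.
Proof.
apply: sqn_le => s us.
rewrite -(big_map (fun h => (g^-1 * h)%g) xpredT (fun i => sqmod (x i))).
by apply: sum_le_sqn; rewrite map_inj_uniq //; apply: mulgI.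
Qed.

Lemma regular_linear g : linear (regular g : H -> H).
Proof. by move=> a x y; apply: ell2P. Qed.

Lemma bounded_regular g : bounded_op (regular g : H -> H).
Proof.
apply/bounded_opP; split; first exact: regular_linear.
by exists 1 => // x; rewrite mul1r sqn_regular.
Qed.

Lemma regularK g : cancel (regular g : H -> H) (regular g^-1%g).
Proof.
by move=> x; rewrite -[LHS]/((regular g^-1%g \o regular g) x) -regularM mulVg regular1.
Qed.

Lemma regularVK g : cancel (regular g^-1%g : H -> H) (regular g).
Proof.
by move=> x; rewrite -[LHS]/((regular g \o regular g^-1%g) x) -regularM mulgV regular1.
Qed.

Fact right_regular_subproof g (x : H) :
  (fun h => x (h * g)%g) \in @sqsummable R G.
Proof.
rewrite unfold_in; apply: le_lt_trans (ltry (sqn x)); apply: sqnorm_le => s us.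
rewrite -(big_map (fun h => (h * g)%g) xpredT (fun i => sqmod (x i))).
by apply: sum_le_sqn; rewrite map_inj_uniq //; apply: mulIg.
Qed.
Definition right_regular g (x : H) : H := Ell2 (right_regular_subproof g x).

Lemma right_regular_commutant g N :
  commutant [set regular h | h in N] (right_regular g).
Proof.
split.
  apply/bounded_opP; split; first by move=> a x y; apply: ell2P.
  exists 1 => // x; rewrite mul1r; apply: sqn_le => s us.
  rewrite -(big_map (fun h => (h * g)%g) xpredT (fun i => sqmod (x i))).
  by apply: sum_le_sqn; rewrite map_inj_uniq //; apply: mulIg.
move=> _ [h _ <-]; apply/funext => x; apply: ell2P => i /=.
by rewrite mulgA.
Qed.

Lemma right_regular_delta g h : right_regular g (delta R h) = delta R (h * g^-1)%g.
Proof.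
apply: ell2P => i; rewrite -[LHS]/(delta R h (i * g)%g) !deltaE; congr ((_ : bool)%:R).
by apply/eqP/eqP => [<-|->]; rewrite ?mulgVK ?mulgK.
Qed.

(** T commutes with right translations, so its matrix is constant along the
orbits (j, i) |-> (j h, i h). *)
Lemma group_vnaE N T i j : group_vna R N T ->
  T (delta R i) j = fourier_coef T (j * i^-1)%g.
Proof.
move=> [_ hT]; rewrite /fourier_coef.
have := hT _ (right_regular_commutant i^-1%g N).
move=> /(congr1 (fun f : H -> H => f (delta R 1%g) j)) /=.
by rewrite right_regular_delta invgK mul1g => ->.
Qed.

Lemma group_vna_bounded N T : group_vna R N T -> bounded_op T.
Proof. by case. Qed.

Lemma fourier_coef_conj N T g h : group_vna R N T ->
  fourier_coef (regular h \o T \o regular h^-1%g) g = fourier_coef T (h^-1 * g * h)%g.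
Proof.
move=> hT; rewrite /fourier_coef /= regular_delta mulg1 (group_vnaE _ _ hT).
by rewrite invgK.
Qed.

Lemma regular_group_vna N g : N g -> group_vna R N (regular g).
Proof. by move=> Ng; apply: sub_bicommutant; [exact: bounded_regular|exists g]. Qed.

(** The element \sum_(j <- r) a_j g_j of the group algebra, acting on the left;
the family g is allowed to repeat. *)
Definition galg (J : Type) (r : seq J) (a : J -> R[i]) (g : J -> G) (x : H) : H :=
  \sum_(j <- r) a j *: regular (g j) x.

Lemma bounded_galg (J : Type) (r : seq J) a (g : J -> G) : bounded_op (galg r a g).
Proof. by apply: bounded_op_sum => j; apply: bounded_regular. Qed.

(** The bound does not depend on g, as weak limits of families require. *)
Lemma sqn_galg (J : eqType) (r : seq J) a (g : J -> G) (x : H) :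
  sqn (galg r a g x) <= 4 ^+ size r * (\sum_(j <- r) sqmod (a j)) * sqn x.
Proof.
have p0 : 0 <= \sum_(j <- r) sqmod (a j) by apply: sumr_ge0 => j _; apply: sqmod_ge0.
rewrite -mulrA; apply: sqn_sum; first by rewrite mulr_ge0 ?sqn_ge0.
move=> j jr; apply: le_trans (sqnZ _ _) _.
apply: ler_pM; rewrite ?sqmod_ge0 ?sqn_ge0 ?sqn_regular //.
elim: r jr {p0} => // i r IH; rewrite inE big_cons => /predU1P[->|/IH h].
  by rewrite lerDl sumr_ge0 // => k _; apply: sqmod_ge0.
by apply: le_trans h _; rewrite lerDr sqmod_ge0.
Qed.

Lemma fourier_coef_galg (J : Type) (r : seq J) a (g : J -> G) h :
  fourier_coef (galg r a g) h = \sum_(j <- r) a j * (h == g j)%:R.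
Proof.
rewrite /fourier_coef /galg ell2_sum; apply: eq_bigr => j _.
by rewrite regular_delta mulg1 ell2Z deltaE.
Qed.

Lemma bicommutant_galg M (J : eqType) (r : seq J) a (g : J -> G) :
  (forall j, j \in r -> a j != 0 -> bicommutant M (regular (g j))) ->
  bicommutant M (galg r a g).
Proof.
move=> h; apply: commutant_sum => // [S|j]; last exact: bounded_regular.
exact: commutant_linear.
Qed.

Lemma galg_comp (J K : Type) (r : seq J) (s : seq K) a b (g : J -> G) (h : K -> G) :
  galg r a g \o galg s b h = galg [seq (j, k) | j <- r, k <- s]
    (fun p => a p.1 * b p.2) (fun p => (g p.1 * h p.2)%g).
Proof.
apply/funext => x; rewrite /galg /= big_allpairs_dep; apply: eq_bigr => j _.
rewrite (lin_sum _ _ (regular_linear _)) scaler_sumr; apply: eq_bigr => k _.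
by rewrite regularM /= (linZ _ _ (regular_linear _)) scalerA.
Qed.

Lemma bicommutant_coef_limit M (U : nat -> H -> H) T (C : R) :
  M `<=` group_vna R [set: G] -> (forall n, bicommutant M (U n)) ->
  (forall n x, sqn (U n x) <= C * sqn x) -> group_vna R [set: G] T ->
  (forall g, tends0 (fun n => fourier_coef (U n) g - fourier_coef T g)) ->
  bicommutant M T.
Proof.
move=> ML MU hU hT hlim.
have bcm S : bicommutant M S -> group_vna R [set: G] S.
  move=> [bS hS]; split=> // V hV; apply: hS; split; first by case: hV.
  by move=> W /ML [_ /(_ V hV)].
apply: (bicommutant_limit MU hU (group_vna_bounded hT)) => i j.
rewrite (group_vnaE i j hT).
under eq_fun do rewrite (group_vnaE _ _ (bcm _ (MU _))); exact: hlim.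
Qed.

(** Let S commute with N.  A finite partial sum T_r of the Fourier series of T
commutes with S.  The vector T_r (delta l) approximates T (delta l) in norm, and
the coordinate (T_r y) j approximates (T y) j by row_approx, where
y = S (delta l); the set r is taken large enough for both. *)
Theorem group_vna_support N T : group_vna R [set: G] T ->
  (forall g, fourier_coef T g != 0 -> N g) -> group_vna R N T.
Proof.
move=> hT hN; have bT := group_vna_bounded hT; split=> // S MS.
have bS : bounded_op S by case: MS.
have /bounded_opP[lS [c c0 hc]] := bS.
apply: bounded_op_ext; [exact: bounded_op_comp|exact: bounded_op_comp|].
move=> l j /=; apply/eqP; rewrite -subr_eq0; apply/eqP.
apply: (@sqmod_small _ _ (2 * c + 2)) => [|e e0]; first by rewrite addr_ge0 ?mulr_ge0.
set y := S (delta R l).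
have [s1 us1 h1] := row_approx j bT (sqn_ge0 y) e0.
have [s2 us2 h2] := trunc_approx (T (delta R l)) e0.
pose r := undup ([seq (j * i^-1)%g | i <- s1] ++ [seq (i * l^-1)%g | i <- s2]).
have ur : uniq r by apply: undup_uniq.
pose a := fourier_coef T.
have ut1 : uniq [seq (g^-1 * j)%g | g <- r].
  by rewrite map_inj_uniq // => u v /mulIg /invg_inj.
have ut2 : uniq [seq (g * l)%g | g <- r].
  by rewrite map_inj_uniq // => u v /mulIg.
have st1 : {subset s1 <= [seq (g^-1 * j)%g | g <- r]}.
  move=> i is1; apply/mapP; exists (j * i^-1)%g; last by rewrite invgM invgK mulgVK.
  by rewrite mem_undup mem_cat; apply/orP; left; apply/mapP; exists i.
have st2 : {subset s2 <= [seq (g * l)%g | g <- r]}.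
  move=> i is2; apply/mapP; exists (i * l^-1)%g; last by rewrite mulgVK.
  by rewrite mem_undup mem_cat; apply/orP; right; apply/mapP; exists i.
have {h1} := h1 _ ut1 st1 y (lexx _).
have {h2} := h2 _ ut2 st2.
have -> : trunc [seq (g * l)%g | g <- r] (T (delta R l)) = galg r a id (delta R l).
  rewrite /trunc /galg big_map; apply: eq_bigr => g _.
  by rewrite regular_delta (group_vnaE _ _ hT) mulgK.
have -> : \sum_(i <- [seq (g^-1 * j)%g | g <- r]) y i * T (delta R i) j =
          galg r a id y j.
  rewrite big_map /galg ell2_sum; apply: eq_bigr => g _.
  by rewrite (group_vnaE _ _ hT) invgM invgK mulVKg mulrC.
have Sa : S (galg r a id (delta R l)) = galg r a id y.
  have : commutant [set S] (galg r a id).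
    apply: commutant_sum => [_ -> //|g|g _ ag]; first exact: bounded_regular.
    split; first exact: bounded_regular.
    move=> _ ->; case: MS => _ /(_ (regular g)) -> //.
    by exists g => //; apply: hN.
  by move=> [_ /(_ S erefl) /(congr1 (fun f : H -> H => f (delta R l)))].
set z := T (delta R l) - _ => h2 h1.
have -> : S (T (delta R l)) j - T y j = S z j + - (T y j - galg r a id y j).
  by rewrite /z linB // ell2D ell2N Sa; ring.
apply: le_trans (sqmodD _ _) _; rewrite sqmodN.
have := le_trans (sqmod_le_sqn (S z) j) (hc z).
have : c * sqn z <= c * e by rewrite ler_wpM2l.
by move: h1; lra.
Qed.

End GroupOperators.

(** * Weak limits of group algebra elements *)
Section GroupAlgebraLimits.
Variables (R : realType) (G : groupType).
Local Notation H := (ell2 R G).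
Implicit Types (S T : H -> H) (M : set (H -> H)) (g h : G).

Lemma galg_translate (J : Type) (r : seq J) (a : J -> R[i]) (g : J -> G) h h' :
  regular h \o galg r a g \o regular h' = galg r a (fun j => h * g j * h')%g.
Proof.
apply/funext => x; rewrite /galg /= (lin_sum _ _ (regular_linear _)).
apply: eq_bigr => j _; rewrite (linZ _ _ (regular_linear _)).
by rewrite !regularM.
Qed.

Lemma fourier_coef_comp_galg N T (J : Type) (r : seq J) (a : J -> R[i]) (g : J -> G) h :
  group_vna R N T -> fourier_coef (T \o galg r a g) h =
  \sum_(j <- r) a j * fourier_coef T (h * (g j)^-1)%g.
Proof.
move=> hT; have [lT _] := group_vna_bounded hT.
rewrite /fourier_coef /galg /= lin_sum // ell2_sum; apply: eq_bigr => j _.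
by rewrite linZ // ell2Z regular_delta mulg1 (group_vnaE _ _ hT).
Qed.

Lemma fourier_coef_galg_comp T (J : Type) (r : seq J) (a : J -> R[i]) (g : J -> G) h :
  fourier_coef (galg r a g \o T) h =
  \sum_(j <- r) a j * fourier_coef T ((g j)^-1 * h)%g.
Proof. by rewrite /fourier_coef /galg /= ell2_sum; apply: eq_bigr. Qed.

Lemma tends0_fourier_coef T (s : nat -> G) :
  escapes s -> tends0 (fun n => fourier_coef T (s n)).
Proof. exact: tends0_escapes. Qed.

(** The form in which weak limits are used to isolate one group element: all the
other terms of the sum run off to infinity. *)
Lemma bicommutant_galg_limit M (J : eqType) (r : seq J) (a : J -> R[i])
    (g : nat -> J -> G) (j0 : J) g0 :
  M `<=` group_vna R [set: G] ->
  (forall n, bicommutant M (galg r a (g n))) ->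
  uniq r -> j0 \in r -> a j0 != 0 -> (forall n, g n j0 = g0) ->
  (forall j, j \in r -> j != j0 -> escapes (fun n => g n j)) ->
  bicommutant M (regular g0).
Proof.
move=> ML MU ur rj0 aj0 gj0 hesc.
have hT : bicommutant M (galg [:: j0] a (fun=> g0)).
  apply: (bicommutant_coef_limit ML MU).
  - by move=> n x; apply: sqn_galg.
  - by apply: bicommutant_galg => j _ _; apply: regular_group_vna.
  - move=> h; rewrite fourier_coef_galg big_seq1.
    have -> : (fun n => fourier_coef (galg r a (g n)) h - a j0 * (h == g0)%:R) =
        fun n => \sum_(j <- rem j0 r) a j * (h == g n j)%:R.
      apply/funext => n; rewrite fourier_coef_galg (big_rem _ rj0) /= gj0.
      by rewrite addrAC subrr add0r.
    apply: tends0_sum => j; rewrite (rem_filter _ ur) mem_filter /= => /andP[jj0 jr].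
    apply: tends0M; apply: tends0_near0; near=> n.
    case: eqP => // hg; exfalso; move: (esym hg).
    by near: n; apply: hesc.
have -> : regular g0 = fun x => \sum_(i <- [:: tt]) (a j0)^-1 *: galg [:: j0] a (fun=> g0) x.
  apply/funext => x; rewrite big_seq1 /galg big_seq1 scalerA mulVf // scale1r //.
apply: commutant_sum => //; first by move=> S; apply: commutant_linear.
by move=> _; apply: bounded_galg.
Unshelve. all: by end_near. Qed.

End GroupAlgebraLimits.

(** * Finite groups of roots of unity *)
Section FiniteGroups.
Variable k : fieldType.

Lemma perm_mulg (F : {fset units k}) s : group_closed (mem F) -> s \in F ->
  perm_eq [seq (s * f)%g | f <- F] F.
Proof.
move=> F_group sF.
apply: uniq_perm => [||x]; rewrite ?fset_uniq ?map_inj_uniq ?fset_uniq //; first exact: mulgI.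
apply/mapP/idP => [[y yF ->]|xF]; first exact: (group_closedM F_group).
exists (s^-1 * x)%g; last by rewrite mulVKg.
by apply: (group_closedM F_group) => //; apply: (group_closedV F_group).
Qed.

End FiniteGroups.

Section RootsOfUnity.
Variable k : fieldType.
Hypothesis char0 : [pchar k] =i pred0.

Local Notation pZ := (map_poly (intr : int -> k)).
Local Notation pQ := (map_poly (intr : int -> rat)).

Lemma natr_char0_eq0 n : (n%:R == 0 :> k) = (n == 0%N).
Proof. by have /pcharf0P -> := char0. Qed.

Lemma intr_char0_eq0 (a : int) : (a%:~R == 0 :> k) = (a == 0).
Proof.
case: a => n; first exact: natr_char0_eq0.
by rewrite NegzE mulrNz oppr_eq0 oppr_eq0; apply: natr_char0_eq0.
Qed.

Lemma root_Cyclotomic_prim n (z : k) : n.-primitive_root z -> root (pZ 'Phi_n) z.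
Proof.
move=> pz; have n0 := prim_order_gt0 pz.
have : root (pZ ('X^n - 1)) z.
  by rewrite rmorphB rmorph1 rmorphXn /= map_polyX /root !hornerE (prim_expr_order pz) subrr.
rewrite -prod_Cyclotomic // rmorph_prod /= rootE horner_prod prodf_seq_eq0.
move=> /hasP[d dn /= rd].
have dn' : (d %| n)%N by rewrite dvdn_divisors.
have d0 : (0 < d)%N := dvdn_gt0 n0 dn'.
suff : (n %| d)%N by move=> nd; have /eqP <- : d == n by rewrite eqn_dvd dn' nd.
rewrite (prim_order_dvd pz); apply/eqP/subr0_eq.
have : root (pZ ('X^d - 1)) z.
  rewrite -prod_Cyclotomic // rmorph_prod /= rootE horner_prod prodf_seq_eq0.
  apply/hasP; exists d => //.
  by rewrite -dvdn_divisors.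
by rewrite rmorphB rmorph1 rmorphXn /= map_polyX /root !hornerE => /eqP.
Qed.

(** The cyclotomic polynomial is irreducible over the rationals.  So either it
divides P, and then P vanishes at y, or it is prime to P, and then a Bezout
relation with denominators cleared gives a nonzero integer that vanishes
in k. *)
Lemma prim_root_conjugate n (z y : k) (P : {poly int}) :
  n.-primitive_root z -> n.-primitive_root y ->
  root (pZ P) z -> root (pZ P) y.
Proof.
move=> pz py rz; have n0 := prim_order_gt0 pz.
have [w pw] := C_prim_root_exists n0.
have [p [Dp mon_p] dv_p] := minCpolyP w.
have pE : p = pQ 'Phi_n.
  apply: (map_poly_inj (ratr : {rmorphism rat -> algC})).
  rewrite -Dp (minCpoly_cyclotomic pw) -(Cintr_Cyclotomic pw) -map_poly_comp.
  by apply: eq_map_poly => a /=; rewrite ratr_int.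
have inj : injective pQ by apply: map_inj_poly => //; apply: intr_inj.
have scaleE (a : int) (q : {poly rat}) (q' : {poly int}) : a != 0 ->
    q = a%:~R^-1 *: pQ q' -> pQ q' = a%:~R *: q.
  by move=> a0 ->; rewrite scalerA mulfV ?intr_eq0 // scale1r.
have [/dvdpP[q qE]|ndv] := boolP (p %| pQ P).
  have [q' [a a0 /scaleE hq]] := rat_poly_scale q.
  have PE : a *: P = q' * 'Phi_n.
    by apply: inj; rewrite rmorphM /= hq // linearZ /= qE pE -scalerAl.
  have /(congr1 (fun f => f.[y])) := congr1 pZ PE.
  rewrite rmorphM /= map_polyZ hornerM hornerZ (rootP (root_Cyclotomic_prim py)) mulr0.
  by move/eqP; rewrite mulf_eq0 intr_char0_eq0 (negPf a0).
have : coprimep p (pQ P).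
  rewrite /coprimep; set d := gcdp _ _.
  have /dvdpP[e eE] : d %| p by apply: dvdp_gcdl.
  have dP : d %| pQ P by apply: dvdp_gcdr.
  have p0 : p != 0 by apply: monic_neq0.
  have [e0 d0] : e != 0 /\ d != 0.
    by move: p0; rewrite eE mulf_eq0 negb_or => /andP.
  have : root (map_poly ratr p) w by rewrite dv_p.
  rewrite eE rmorphM /= rootM !dv_p => /orP[pe|pd].
    have := dvdp_leq e0 pe; rewrite eE size_mul // -ltnS.
    have : (0 < size d)%N by rewrite size_poly_gt0.
    have : (0 < size e)%N by rewrite size_poly_gt0.
    case: (size e) (size d) => // m [|[|l]] //= _ _.
    by rewrite !addnS /= ltnS ltnS ltnNge leq_addr.
  by case/negP: ndv; apply: dvdp_trans pd dP.
move=> /Bezout_eq1_coprimepP[[u v] /= uv].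
have [u' [a a0 /scaleE hu]] := rat_poly_scale u.
have [v' [b b0 /scaleE hv]] := rat_poly_scale v.
have E : b *: u' * 'Phi_n + a *: v' * P = (a * b)%:P.
  apply: inj; rewrite rmorphD !rmorphM /= !map_polyZ /= hu // hv // !map_polyC /= -pE.
  rewrite !scalerA -!scalerAl [b%:~R * _]mulrC -scalerDr uv.
  by rewrite alg_polyC polyCM.
have /(congr1 (fun f => f.[z])) := congr1 pZ E.
rewrite rmorphD !rmorphM /= hornerD !hornerM (rootP (root_Cyclotomic_prim pz)) (rootP rz).
rewrite !mulr0 addr0 !map_polyC !hornerC => /esym/eqP.
by rewrite /= mulf_eq0 !intr_char0_eq0 (negPf a0) (negPf b0).
Qed.

Lemma prim_rootV n (z : k) : n.-primitive_root z -> n.-primitive_root z^-1.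
Proof.
move=> pz; have n0 := prim_order_gt0 pz.
have -> : z^-1 = z ^+ n.-1.
  have z0 : z != 0.
    apply/eqP => z0; have := prim_expr_order pz.
    by rewrite z0 expr0n eqn0Ngt n0 => /esym/eqP; rewrite oner_eq0.
  by apply: (mulfI z0); rewrite mulfV // -exprS prednK // (prim_expr_order pz).
by rewrite prim_root_exp_coprime // coprimePn.
Qed.

Lemma prim_root_invert n (z : k) (P : {poly int}) :
  n.-primitive_root z -> root (pZ P) z -> root (pZ P) z^-1.
Proof. by move=> pz; apply: prim_root_conjugate (prim_rootV pz). Qed.

Variable F : {fset units k}.
Hypothesis F_group : group_closed (mem F).

Lemma fset_group_expr (f : units k) : f \in F -> (unit_val f) ^+ #|` F| = 1.
Proof.
move=> fF; have : \prod_(x <- F) unit_val x != 0.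
  by rewrite prodf_seq_neq0; apply/allP => x _; apply: unit_neq0.
move/mulIf; apply; rewrite mul1r -[RHS](perm_big _ (perm_mulg F_group fF)) big_map /=.
by rewrite big_split /= big_const_seq count_predT iter_mulr_1.
Qed.

Lemma fset_group_prim : exists2 z : k, (#|` F|).-primitive_root z &
  forall f : units k, f \in F -> exists i, unit_val f = z ^+ i.
Proof.
have F0 : (0 < #|` F|)%N.
  by rewrite cardfs_gt0; apply/fset0Pn; exists 1%g; case: F_group.
have /hasP[z _ pz] : has (#|` F|).-primitive_root [seq unit_val x | x <- F].
  apply: has_prim_root => //; rewrite ?size_map //.
    by apply/allP => _ /mapP[x xF ->]; apply/unity_rootP; apply: fset_group_expr.
  by rewrite map_inj_uniq ?fset_uniq //; apply: val_inj.
exists z => // f fF; have [i ->] := prim_rootP pz (fset_group_expr fF).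
by exists i.
Qed.

(** Inverting the roots of unity in 1 - g = f (1 - g0) yields a second relation,
1 - g^-1 = f^-1 (1 - g0^-1).  Together they give g = f^2 g0, and then
(1 - f) (1 + f g0) = 0.  Geometrically, two chords of the unit circle that start
at 1 and have the same length are equal or complex conjugate. *)
Lemma chord_ratio (g g0 f : units k) : g \in F -> g0 \in F -> f \in F ->
  unit_val g0 != 1 -> 1 - unit_val g = unit_val f * (1 - unit_val g0) ->
  (f = 1%g /\ g = g0) \/ (unit_val f * unit_val g0 = -1 /\ unit_val g * unit_val g0 = 1).
Proof.
move=> gF g0F fF g01 E.
have [z pz hz] := fset_group_prim.
have [a ga] := hz _ gF; have [b gb] := hz _ g0F; have [c fc] := hz _ fF.
have E' : 1 - (unit_val g)^-1 = (unit_val f)^-1 * (1 - (unit_val g0)^-1).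
  pose P : {poly int} := 1 - 'X^a - 'X^c * (1 - 'X^b).
  have PE y : (pZ P).[y] = 1 - y ^+ a - y ^+ c * (1 - y ^+ b).
    rewrite /P !rmorphB rmorphM !rmorphB !rmorph1 !rmorphXn /= map_polyX.
    by rewrite !hornerE.
  have : root (pZ P) z^-1.
    apply: prim_root_invert pz _; apply/rootP; rewrite PE.
    by rewrite -ga -gb -fc E subrr.
  by move/rootP; rewrite PE !exprVn -ga -gb -fc => /subr0_eq.
have := unit_neq0 g; have := unit_neq0 g0; have := unit_neq0 f.
have hval (s t : units k) : unit_val s = unit_val t -> s = t by apply: val_inj.
have h1 : f = 1%g -> f = 1%g /\ g = g0.
  move=> f1; split=> //; apply: hval.
  by move: E; rewrite f1 /= mul1r => /addrI /oppr_inj.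
have h2 : unit_val f = 1 -> f = 1%g by apply: (hval f 1%g).
move: h1 h2 E E' g01; move: (unit_val f) (unit_val g) (unit_val g0) => x y t h1 h2 E E' t1 x0 t0 y0.
have t1' : 1 - t != 0 by rewrite subr_eq0 eq_sym.
have yE : y = x ^+ 2 * t.
  apply: (mulIf t1').
  have : (1 - y^-1) * (x * y * t) = x^-1 * (1 - t^-1) * (x * y * t) by rewrite E'.
  have -> : (1 - y^-1) * (x * y * t) = - ((1 - y) * x * t) by field.
  have -> : x^-1 * (1 - t^-1) * (x * y * t) = - (y * (1 - t)) by field; rewrite ?t0 ?x0.
  by rewrite E => /oppr_inj <-; ring.
have /eqP : (1 - x) * (1 + x * t) = 0.
  by move: E; rewrite yE => /eqP; rewrite -subr_eq0 => /eqP <-; ring.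
rewrite mulf_eq0 subr_eq0 addrC addr_eq0 => /orP[/eqP x1|/eqP xt].
  by left; apply: h1; apply: h2.
right; split=> //; rewrite yE (_ : x ^+ 2 * t * t = (x * t) ^+ 2); last by ring.
by rewrite xt sqrrN expr1n.
Qed.

End RootsOfUnity.

(** * Polynomial sequences that leave every finite set *)
Section Escape.
Variable k : fieldType.
Hypothesis char0 : [pchar k] =i pred0.

(** A nonzero polynomial has finitely many roots, and in characteristic zero
distinct naturals are distinct in k. *)
Lemma near_horner_neq0 (p : {poly k}) : p != 0 ->
  \forall n \near \oo, p.[n%:R] != 0.
Proof.
have [m] := ubnP (size p); elim: m p => // m IH p sp p0.
have [[n0 /eqP r0]|h] := pselect (exists n, p.[n%:R] == 0); last first.
  by apply: nearW => n; apply/negP => hn; apply: h; exists n.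
have /factor_theorem[q pE] : root p n0%:R by apply/rootP.
have q0 : q != 0 by apply: contraNneq p0 => q0; rewrite pE q0 mul0r.
have sq : (size q < m)%N.
  by move: sp; rewrite pE size_Mmonic ?monicXsubC // size_XsubC addn2.
have hq := IH q sq q0.
near=> n.
rewrite pE hornerM mulf_neq0 //; first by near: n.
rewrite hornerXsubC subr_eq0.
have n0n : (n0 < n)%N by near: n; exact: nbhs_infty_gt.
rewrite -subr_eq0 -natrB ?(ltnW n0n) // natr_char0_eq0 //.
by rewrite -lt0n subn_gt0.
Unshelve. all: by end_near. Qed.

Lemma escapes_quadratic (a b c : k) : (b != 0) || (c != 0) ->
  escapes (fun n => a + n%:R * b + n%:R ^+ 2 * c).
Proof.
move=> bc v; pose p := (a - v)%:P + 'X * b%:P + 'X^2 * c%:P.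
have pE x : p.[x] = a + x * b + x ^+ 2 * c - v.
  by rewrite /p !hornerE; ring.
have p0 : p != 0.
  apply: contraL bc => /eqP p0.
  have := congr1 (fun q : {poly k} => q`_1) p0; have := congr1 (fun q : {poly k} => q`_2) p0.
  rewrite /p !(coefD, coefMC, coefC, coefXn, coefX) /= !(mul0r, mul1r, add0r, addr0).
  by move=> -> ->; rewrite eqxx.
near=> n; have : p.[n%:R] != 0 by near: n; apply: near_horner_neq0.
by rewrite pE subr_eq0 => /eqP.
Unshelve. all: by end_near. Qed.

Lemma escapes_linear (a b : k) : b != 0 -> escapes (fun n => a + n%:R * b).
Proof.
move=> b0; have := @escapes_quadratic a b 0; rewrite b0 => /(_ isT).
by under eq_fun do rewrite mulr0 addr0.
Qed.

Lemma escapes_quotient (a : k) : a != 0 -> escapes (fun n => n.+1%:R^-1 * a).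
Proof.
move=> a0 v; have [->|v0] := eqVneq v 0.
  apply: nearW => n /eqP; rewrite mulf_eq0 invr_eq0 natr_char0_eq0 //.
  by rewrite (negPf a0).
have h := escapes_linear v v0 a.
near=> n => e; have : v + n%:R * v <> a by near: n; apply: h.
apply; rewrite -e -[X in X + _]mul1r -mulrDl nat1r mulrA mulfV ?mul1r //.
by rewrite natr_char0_eq0.
Unshelve. all: by end_near. Qed.

Lemma escapes_pair (T : Type) (x : nat -> k) (t : T) :
  escapes x -> escapes (fun n => (x n, t)).
Proof.
by move=> hx [y u]; near=> n => -[e _]; move: e; near: n; apply: hx.
Unshelve. all: by end_near. Qed.

End Escape.

(** * The affine group *)
Section AffineGroup.
Variable k : fieldType.
Implicit Types (p q : k) (s t : units k).

Definition dilation s : affine k := (0, s).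

Lemma affM (g h : affine k) :
  (g * h)%g = (g.1 + unit_val g.2 * h.1, (g.2 * h.2)%g) :> affine k.
Proof. by []. Qed.

Lemma affV (g : affine k) :
  (g^-1)%g = (- ((unit_val g.2)^-1 * g.1), (g.2^-1)%g) :> affine k.
Proof. by []. Qed.

Lemma unit_valM s t : unit_val (s * t)%g = unit_val s * unit_val t.
Proof. by []. Qed.

Lemma unit_val1 : unit_val (1%g : units k) = 1. Proof. by []. Qed.

Lemma unit_val_inj : injective (@unit_val k). Proof. exact: val_inj. Qed.

Lemma translationV q : (translation q)^-1%g = translation (- q).
Proof. by rewrite affV /translation /= invr1 mul1r invg1. Qed.

Lemma translationM p q : (translation p * translation q)%g = translation (p + q).
Proof. by rewrite affM /translation /= mul1r mulg1. Qed.

End AffineGroup.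

(** * Invariant subalgebras with center L(k)^F *)
Section InvariantSubalgebra.
Variables (R : realType) (k : fieldType).
Hypothesis char0 : [pchar k] =i pred0.
Variable F : {fset units k}.
Hypothesis F_group : group_closed (mem F).
Local Notation H := (ell2 R (affine k)).
Implicit Types (S T : H -> H) (f g s : units k) (p q r : k).

Let F1 : 1%g \in F. Proof. by case: F_group. Qed.

(** As p varies, these finite elements of L(k)^F detect the elements of L(G) that
commute with it. *)
Definition orbit_sum (p : k) : H -> H :=
  galg F (fun=> 1) (fun f => translation (p * unit_val f)).

Lemma orbit_sum_fixed p : L_translations_fixed R F (orbit_sum p).
Proof.
split.
  by apply: bicommutant_galg => f _ _; apply: regular_group_vna; exists (p * unit_val f).
move=> q f fF; rewrite !fourier_coef_galg.
rewrite -[RHS](perm_big _ (perm_mulg F_group fF)) big_map; apply: eq_bigr => g _.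
congr (_ * (_ : bool)%:R); rewrite /translation !xpair_eqE !eqxx !andbT.
by rewrite unit_valM mulrCA [q * _]mulrC (inj_eq (mulfI (unit_neq0 f))).
Qed.

(** In the commutation relation at (q + n, s) with p = n, one side has the
arguments q + n (1 - s f) and the other q + n (1 - f).  The first never stay put,
since s f = 1 would put s in F; the second do so for f = 1 only. *)
Lemma commute_orbit_sum_coef T q s : group_vna R [set: affine k] T ->
  (forall p, T \o orbit_sum p = orbit_sum p \o T) -> s \notin F ->
  fourier_coef T (q, s) = 0.
Proof.
move=> hT hc sF.
pose u n := \sum_(f <- F) fourier_coef T (q + n%:R * (1 - unit_val s * unit_val f), s).
have uE n : u n = \sum_(f <- F) fourier_coef T (q + n%:R * (1 - unit_val f), s).
  have := congr1 (fun U : H -> H => fourier_coef U ((q + n%:R, s) : affine k)) (hc n%:R).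
  rewrite (fourier_coef_comp_galg _ _ _ _ hT) fourier_coef_galg_comp /u => E.
  transitivity (\sum_(j <- F) 1 * fourier_coef T
    (((q + n%:R, s) : affine k) * (translation (n%:R * unit_val j))^-1)%g).
    apply: eq_bigr => f _; rewrite mul1r translationV affM /= mulg1.
    by congr (fourier_coef T (_, _)); ring.
  rewrite {}E; apply: eq_bigr => f _; rewrite mul1r translationV affM /= mul1g.
  by congr (fourier_coef T (_, _)); ring.
symmetry; apply: (@tends0_uniq R u).
  under eq_fun do rewrite subr0; rewrite /u.
  apply: tends0_sum => f fF; apply: tends0_fourier_coef.
  apply/escapes_pair/escapes_linear => //; rewrite subr_eq0.
  apply: contra sF => /eqP sf.
  suff -> : s = f^-1%g by apply: (group_closedV F_group).
  apply: unit_val_inj; apply: (mulIf (unit_neq0 f)).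
  by rewrite -sf /= mulVf ?unit_neq0.
under eq_fun do rewrite uE (big_rem _ F1) /= subrr mulr0 addr0 addrAC subrr add0r.
apply: tends0_sum => f; rewrite (rem_filter _ (fset_uniq F)) mem_filter /= => /andP[f1 fF].
apply: tends0_fourier_coef; apply/escapes_pair/escapes_linear => //.
by rewrite subr_eq0 eq_sym; apply: contra f1 => /eqP /(@unit_val_inj _ f 1%g) ->.
Qed.

Variable A : set (H -> H).
Hypothesis A_vn : vn_subalgebra A.
Hypothesis A_inv : conj_invariant A.
Hypothesis A_center : vn_center A = L_translations_fixed R F.

Let AL T : A T -> group_vna R [set: affine k] T.
Proof. by case: A_vn => _; apply. Qed.

Let bicommutantA : bicommutant A = A.
Proof. by case: A_vn => [[]]. Qed.

Lemma mem_conj T (g : affine k) : A T -> A (regular g \o T \o regular g^-1%g).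
Proof. by move=> AT; rewrite -(A_inv g); exists T. Qed.

Lemma mem_comp S T : A S -> A T -> A (S \o T).
Proof. by case: A_vn => [[_ _ _ _ h _ _] _]; apply: h. Qed.

Lemma mem_orbit_sum p : A (orbit_sum p).
Proof.
have : L_translations_fixed R F (orbit_sum p) := orbit_sum_fixed p.
by rewrite -A_center => -[].
Qed.

Lemma coef_notin_eq0 T q s : A T -> s \notin F -> fourier_coef T (q, s) = 0.
Proof.
move=> AT; apply: commute_orbit_sum_coef; first exact: AL.
move=> p; have : L_translations_fixed R F (orbit_sum p) := orbit_sum_fixed p.
by rewrite -A_center => -[_ [_ /(_ T AT)]].
Qed.

(** Conjugation by the dilation n + 1 replaces c(q, s) by c(q / (n + 1), s), which
tends to 0 unless q = 0. *)
Lemma mem_dilation_part T : A T ->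
  A (galg F (fun f => fourier_coef T (dilation f)) (@dilation k)).
Proof.
move=> AT; rewrite -bicommutantA.
have n0 n : n.+1%:R != 0 :> k by rewrite natr_char0_eq0.
pose d n := dilation (Units (n0 n)).
have bT : bounded_op T := group_vna_bounded (AL AT).
have /bounded_opP[lT [c c0 hc]] := bT.
apply: (@bicommutant_coef_limit _ _ A (fun n => regular (d n) \o T \o regular (d n)^-1%g) _ c).
- by move=> S; apply: AL.
- by move=> n; rewrite bicommutantA; apply: mem_conj.
- move=> n x /=; apply: le_trans (sqn_regular _ _) _; apply: le_trans (hc _) _.
  by rewrite ler_wpM2l // sqn_regular.
- by apply: bicommutant_galg => f _ _; apply: regular_group_vna.
move=> [q s]; rewrite fourier_coef_galg.
have E n : fourier_coef (regular (d n) \o T \o regular (d n)^-1%g) (q, s) =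
    fourier_coef T (n.+1%:R^-1 * q, s).
  rewrite (fourier_coef_conj _ _ (AL AT)) affV !affM /= mulr0 !mulr0 oppr0 add0r addr0.
  congr (fourier_coef T (_, _)).
  by apply: unit_val_inj; rewrite /= mulrC mulrA mulfV ?mul1r.
apply: tends0_ext => [n|]; first by rewrite E.
have [->|q0] := eqVneq q 0.
  apply: tends0_near0; apply: nearW => n; rewrite mulr0.
  have [sF|sF] := boolP (s \in F); last first.
    rewrite coef_notin_eq0 // big_seq big1 ?subr0 // => f fF.
    have [[e]|_] := eqVneq (0, s) (dilation f); last by rewrite mulr0.
    by rewrite e fF in sF.
  rewrite (bigD1_seq s) ?fset_uniq //= /dilation eqxx mulr1 big1 ?addr0 ?subrr // => f fs.
  by rewrite xpair_eqE eqxx /= eq_sym (negPf fs) mulr0.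
rewrite big1; last first.
  by move=> f _; rewrite /dilation xpair_eqE (negPf q0) mulr0.
under eq_fun do rewrite subr0.
by apply: tends0_fourier_coef; apply/escapes_pair/escapes_quotient.
Qed.

(** Conjugation by the translation t replaces c(0, s) by c((s - 1) t, s). *)
Lemma exists_dilation_part T q s : A T -> fourier_coef T (q, s) != 0 -> s != 1%g ->
  exists2 a, A (galg F a (@dilation k)) & a s != 0.
Proof.
move=> AT Tqs s1.
have s1' : unit_val s - 1 != 0.
  by rewrite subr_eq0; apply: contra s1 => /eqP /(@unit_val_inj _ s 1%g) ->.
pose t := translation (q / (unit_val s - 1)).
exists (fun f => fourier_coef (regular t \o T \o regular t^-1%g) (dilation f)).
  by apply: mem_dilation_part; apply: mem_conj.
rewrite (fourier_coef_conj _ _ (AL AT)).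
have -> // : (t^-1 * dilation s * t)%g = (q, s).
rewrite translationV !affM /= mulg1 mul1g; congr pair.
by field.
Qed.

(** The powers n and n^2 in the two conjugations make the vanishing of the
translation part split into two equations, which leave a single surviving term. *)
Lemma mem_translation_dilation_sqr (a : units k -> R[i]) s r :
  A (galg F a (@dilation k)) -> s \in F -> s != 1%g -> a s != 0 ->
  A (regular ((r, (s * s)%g) : affine k)).
Proof.
move=> Aa sF s1 as0; rewrite -bicommutantA.
(* The term (f, g, h) = (1, s, s) of the product is carried by
   (P n + (1 - s) n + s (1 - s) n^2, s^2), and P n is chosen to make this
   equal to (r, s^2). *)
pose P n : k := r - (1 - unit_val s) * n%:R - unit_val s * (1 - unit_val s) * n%:R ^+ 2.
pose J := [seq (f, gh) | f <- F, gh <- [seq (g, h) | g <- F, h <- F]].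
pose c (j : units k * (units k * units k)) : R[i] := 1 * (a j.2.1 * a j.2.2).
pose e n (j : units k * (units k * units k)) : affine k :=
  (r * unit_val j.1
    + n%:R * ((1 - unit_val j.2.1) - unit_val j.1 * (1 - unit_val s))
    + n%:R ^+ 2 * (unit_val j.2.1 * (1 - unit_val j.2.2)
                   - unit_val j.1 * unit_val s * (1 - unit_val s)),
   (j.2.1 * j.2.2)%g).
have uJ : uniq J.
  apply: allpairs_uniq; rewrite ?fset_uniq //; last by move=> [? ?] [? ?] _ _ /= [-> ->].
  by apply: allpairs_uniq; rewrite ?fset_uniq // => -[? ?] [? ?] _ _ /= [-> ->].
apply: (@bicommutant_galg_limit R _ A _ J c e (1%g, (s, s))) => //.
- move=> n; rewrite bicommutantA.
  pose t1 := translation (n%:R : k); pose t2 := translation (n%:R ^+ 2 : k).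
  have -> : galg J c (e n) = orbit_sum (P n) \o
      ((regular t1 \o galg F a (@dilation k) \o regular t1^-1%g) \o
       (regular t2 \o galg F a (@dilation k) \o regular t2^-1%g)).
    rewrite !galg_translate !galg_comp; congr galg; apply/funext => -[f [g h]].
    rewrite /e !translationV !affM /= !mul1g !mulg1; congr pair; rewrite /P /=.
    by ring.
  by apply: mem_comp; [exact: mem_orbit_sum|apply: mem_comp; apply: mem_conj].
- apply/allpairsP; exists (1%g, (s, s)); split=> //.
  by apply/allpairsP; exists (s, s).
- by rewrite /c /= mul1r mulf_neq0.
- by move=> n; rewrite /e /= ?mulr1 ?mul1r !subrr !mulr0 !addr0.
move=> [f [g h]] /allpairsP[[f' p'] /= [fF /allpairsP[[g' h'] /= [gF hF ->]] [-> -> ->]]] ne.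
apply/escapes_pair/escapes_quadratic => //.
rewrite -negb_and; apply: contra ne => /= /andP[]; rewrite !subr_eq0 => /eqP E1 /eqP E2.
have sv1 : unit_val s != 1 by apply: contra s1 => /eqP /(@unit_val_inj _ s 1%g) ->.
have ss1 : 1 - unit_val s != 0 by rewrite subr_eq0 eq_sym.
rewrite !xpair_eqE.
have [[f1 gs]|[fs gs]] := chord_ratio char0 F_group gF sF fF sv1 E1.
  rewrite f1 gs !eqxx /=; move: E2; rewrite f1 gs unit_val1 mul1r.
  by move/(mulfI (unit_neq0 s))/addrI/oppr_inj/unit_val_inj ->.
(* The exceptional case f s = -1, g s = 1: multiplying the second equation by s
   gives 1 - h = f s^2 (1 - s), again a ratio of chords.  Either outcome forces
   s = -1, where the exceptional case is the term (1, s, s) itself. *)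
have hF2 : (f' * s * s)%g \in F.
  by apply: (group_closedM F_group) => //; apply: (group_closedM F_group).
have E3 : 1 - unit_val h' = unit_val (f' * s * s)%g * (1 - unit_val s).
  rewrite -[LHS]mul1r -[X in X * _ = _]gs mulrAC E2 !unit_valM; ring.
have sm1 : unit_val s = -1 -> f' = 1%g /\ g' = s.
  move=> sE; split; apply: unit_val_inj.
    by move: fs; rewrite sE mulrN1 => /oppr_inj.
  by move: gs; rewrite sE mulrN1 => /eqP; rewrite eqr_oppLR => /eqP.
have [[f1 hs]|[fs3 hs]] := chord_ratio char0 F_group hF sF hF2 sv1 E3.
  have sE : unit_val s = -1.
    have := congr1 (@unit_val k) f1; rewrite !unit_valM fs mulN1r unit_val1 => /eqP.
    by rewrite eqr_oppLR => /eqP.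
  by have [-> ->] := sm1 sE; rewrite hs !eqxx.
have sE : unit_val s = -1.
  move: fs3; rewrite !unit_valM fs mulN1r mulNr => /oppr_inj /eqP.
  by rewrite -expr2 sqrf_eq1 (negPf sv1) => /eqP.
have [-> ->] := sm1 sE; rewrite !eqxx /= -(inj_eq (@unit_val_inj k)).
by move: hs; rewrite sE mulrN1 => /eqP; rewrite eqr_oppLR => /eqP ->.
Qed.

(** Multiply u_q v_(s^2) by the inverse of v_(s^2), the case q = 0. *)
Lemma mem_translation (a : units k -> R[i]) s q :
  A (galg F a (@dilation k)) -> s \in F -> s != 1%g -> a s != 0 ->
  A (regular (translation q)).
Proof.
move=> Aa sF s1 as0.
have h r := mem_translation_dilation_sqr r Aa sF s1 as0.
have -> : translation q = (((q, s * s) : affine k) * (dilation (s * s))^-1)%g.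
  by rewrite affM affV /= mulgV !mulr0 oppr0 mulr0 addr0.
rewrite regularM; apply: mem_comp => //; rewrite -bicommutantA.
apply: (commutant_inv (bounded_regular _ _) (regularK _) (regularVK _)).
by rewrite -/(bicommutant _) bicommutantA; apply: h.
Qed.

(** Since translations are in A, so is u_n x u_(-n/s); its term at g is carried by
(n (1 - g / s), g), which is constant for g = s only. *)
Lemma mem_dilation (a : units k -> R[i]) s :
  (forall q, A (regular (translation q))) ->
  A (galg F a (@dilation k)) -> s \in F -> a s != 0 -> A (regular (dilation s)).
Proof.
move=> At Aa sF as0; rewrite -bicommutantA.
pose e n g := (translation n%:R * dilation g * translation (- ((unit_val s)^-1 * n%:R)))%g.
have eE n g : e n g = (0 + n%:R * (1 - unit_val g / unit_val s), g).
  rewrite /e !affM /= mulg1 mul1g; congr pair; ring.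
apply: (@bicommutant_galg_limit R _ A _ F a e s) => //.
- move=> n; rewrite bicommutantA /e -galg_translate.
  by apply: mem_comp => //; apply: mem_comp.
- by move=> n; rewrite eE divff ?unit_neq0 // subrr mulr0 addr0.
move=> g gF gs; under eq_fun do rewrite eE.
apply/escapes_pair/escapes_linear => //; rewrite subr_eq0.
apply: contra gs => /eqP e1; apply/eqP/unit_val_inj.
by rewrite -(divfK (unit_neq0 s) (unit_val g)) -e1 mul1r.
Qed.

End InvariantSubalgebra.

(** * The two cases *)
Section Abelian.
Variables (R : realType) (k : fieldType).
Local Notation H := (ell2 R (affine k)).

Lemma L_translations_commute (S T : H -> H) :
  L_translations R k S -> L_translations R k T -> S \o T = T \o S.
Proof.
move=> [_ hS] [bT hT]; symmetry; apply: hS; split=> // _ [_ [p _ <-] <-].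
apply: hT; split; first exact: bounded_regular.
by move=> _ [_ [q _ <-] <-]; rewrite -!regularM !translationM addrC.
Qed.

(** Conjugation by (q, s) permutes the terms of the sum by f |-> s f. *)
Lemma stabilizer_sum_commutant (F : {fset units k}) (P : pred (units k)) :
  group_closed (mem F) ->
  (forall s f, s \in F -> P s -> P (s * f)%g = P f) ->
  commutant [set regular g | g in [set g : affine k | g.2 \in F /\ P g.2]]
    (galg F (fun f => (P f)%:R) (fun f => translation (unit_val f)) : H -> H).
Proof.
move=> F_group hP; split; first exact: bounded_galg.
move=> _ [[q s] /= [sF Ps] <-]; apply/funext => x /=; rewrite /galg.
rewrite (lin_sum _ _ (regular_linear _)).
rewrite -[RHS](perm_big _ (perm_mulg F_group sF)) big_map; apply: eq_bigr => f _.
rewrite (linZ _ _ (regular_linear _)) hP //; congr (_ *: _).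
rewrite -[LHS]/((regular ((q, s) : affine k) \o regular (translation (unit_val f))) x).
rewrite -[RHS]/((regular (translation (unit_val (s * f)%g)) \o regular ((q, s) : affine k)) x).
rewrite -!regularM !affM /= mul1r addrC.
by congr (regular (_ : affine k) x); rewrite mulg1 mul1g.
Qed.

End Abelian.

Theorem lemma4p7 (R : realType) (k : countFieldType)
    (char0 : [pchar k] =i pred0)
    (A : set (ell2 R (affine k) -> ell2 R (affine k)))
    (A_vn : vn_subalgebra A) (A_inv : conj_invariant A)
    (F : {fset units k}) (F_group : group_closed (mem F))
    (F_nontrivial : F != [fset 1%g]%fset)
    (A_center : vn_center A = L_translations_fixed R F) :
  A = L_translations_fixed R F \/ A = L_semidirect R F.
Proof.
have AL T : A T -> group_vna R [set: affine k] T by case: A_vn => _; apply.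
have biA : bicommutant A = A by case: A_vn => [[]].
have suppF T q s : A T -> fourier_coef T (q, s) != 0 -> s \in F.
  move=> AT; apply: contraNT => sF; apply/eqP.
  exact: (coef_notin_eq0 char0 F_group A_vn A_center).
have [[T [q [s [AT Tqs s1]]]]|h] := pselect (exists T q s,
    [/\ A T, fourier_coef T (q, s) != 0 & s != 1%g]); last first.
  left; have AU : A `<=` L_translations R k.
    move=> T AT; apply: (group_vna_support (AL T AT)) => -[q s] Tqs.
    exists q => //; have [->//|s1] := eqVneq s 1%g.
    by case: h; exists T, q, s.
  rewrite -A_center; apply/seteqP; split=> [T AT|T []//].
  split=> //; split; first by case: (AL T AT).
  by move=> S AS; apply: L_translations_commute; apply: AU.
right; have dil := exists_dilation_part char0 F_group A_vn A_inv A_center.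
have Atr p : A (regular (translation p)).
  have sF := suppF _ _ _ AT Tqs.
  have [a Aa as0] := dil _ _ _ AT Tqs s1.
  exact: (mem_translation char0 F_group A_vn A_inv A_center p Aa sF s1 as0).
pose P f := `[< A (regular (dilation f)) >].
have Adil T' q' f : A T' -> fourier_coef T' (q', f) != 0 -> P f.
  move=> AT' Tf; apply/asboolP; have fF := suppF _ _ _ AT' Tf.
  have [->|f1] := eqVneq f 1%g.
    have -> : regular (dilation 1%g) = id :> (ell2 R (affine k) -> _) by apply: regular1.
    by case: A_vn => [[]].
  have [a Aa af0] := dil _ _ _ AT' Tf f1.
  exact: (mem_dilation char0 A_vn Atr Aa fF af0).
have AN : A `<=` group_vna R [set g : affine k | g.2 \in F /\ P g.2].
  move=> T' AT'; apply: (group_vna_support (AL _ AT')) => -[q' f] /= Tf.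
  by split; [apply: suppF Tf | apply: Adil Tf].
have PM s' f : s' \in F -> P s' -> P (s' * f)%g = P f.
  have dM (g h : units k) : dilation (g * h)%g = (dilation g * dilation h)%g.
    by rewrite affM /= mulr0 addr0.
  move=> _ /asboolP As'; apply/asboolP/asboolP => [Asf|Af].
    have -> : f = (s'^-1 * (s' * f))%g by rewrite mulKg.
    rewrite dM regularM; apply: mem_comp => //.
    have -> : dilation s'^-1%g = (dilation s')^-1%g by rewrite affV /= mulr0 oppr0.
    rewrite -biA; apply: (commutant_inv (bounded_regular _ _) (regularK _) (regularVK _)).
    by rewrite -/(bicommutant _) biA.
  by rewrite dM regularM; apply: mem_comp.
(* The coefficients of z on F tell which dilations lie in A.  As z is central in
   A, they are constant, so all of F lies in A as the identity does. *)
pose z : ell2 R (affine k) -> ell2 R (affine k) :=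
  galg F (fun f => (P f)%:R) (fun f => translation (unit_val f)).
have zE f : f \in F -> fourier_coef z (translation (unit_val f)) = (P f)%:R.
  move=> fF; rewrite fourier_coef_galg (bigD1_seq f) ?fset_uniq //= eqxx mulr1.
  rewrite big1 ?addr0 // => g gf; rewrite /translation xpair_eqE eqxx andbT.
  by rewrite (inj_eq (@unit_val_inj k)) eq_sym (negPf gf) mulr0.
have : vn_center A z.
  split; first by rewrite -biA; apply: bicommutant_galg => f _ _; rewrite biA.
  split; first exact: bounded_galg.
  by move=> S /AN [_ ->] //; apply: stabilizer_sum_commutant.
rewrite A_center => -[_ zF].
have F1 : 1%g \in F by case: F_group.
have PF f : f \in F -> P f.
  move=> fF; have := zF 1 f fF; rewrite mul1r zE //.
  rewrite -[X in translation X]/(unit_val (1%g : units k)) zE //.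
  have -> : P 1%g.
    apply/asboolP.
    have -> : regular (dilation 1%g) = id :> (ell2 R (affine k) -> _) by apply: regular1.
    by case: A_vn => [[]].
  by case: (P f) => // /eqP; rewrite oner_eq0.
apply/seteqP; split=> [T' /AN|T'].
  by apply: bicommutantS; apply: image_subset => g [].
rewrite -biA; apply: bicommutantS => _ [[q' f] /= fF <-].
have -> : ((q', f) : affine k) = (translation q' * dilation f)%g.
  by rewrite affM /= mulr0 addr0 mul1g.
by rewrite regularM; apply: mem_comp => //; apply/asboolP; apply: PF.
Qed.
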